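(* Let $H$ be a connected graph on the vertex set $[n]$ which is not a complete graph, and let $G=v*H$ be the cone of $v$ on $H$. Then $\operatorname{depth}_S(S/J_G)=\operatorname{depth}_{S_H}(S_H/J_H)$. In particular, if $H$ is Cohen-Macaulay, then $G$ is almost Cohen-Macaulay.
   Context: $\mathbb{K}$ is an arbitrary field and all graphs are finite and simple; $[n]=\{1,\dots,n\}$. For a graph $\Gamma$, its binomial edge ideal $J_\Gamma$ is the ideal of the polynomial ring $\mathbb{K}[x_u,y_u : u\in V(\Gamma)]$ generated by the binomials $x_uy_w-x_wy_u$ with $\{u,w\}\in E(\Gamma)$. The cone $v*H$ has vertex set $V(H)\sqcup\{v\}$ and edge set $E(H)\sqcup\{\{v,u\} : u\in V(H)\}$. Put $S_H=\mathbb{K}[x_i,y_i : i\in V(H)]$ and $S=S_H[x_v,y_v]$. Depth is with respect to the graded maximal ideal. For a finitely generated graded module $M$ over a polynomial ring, the Cohen-Macaulay defect is $\operatorname{cmdef}(M)=\dim(M)-\operatorname{depth}(M)$, and $M$ is almost Cohen-Macaulay if $\operatorname{cmdef}(M)=1$. A graph is (almost) Cohen-Macaulay if the quotient of its polynomial ring by its binomial edge ideal is (almost) Cohen-Macaulay. *)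

(* Defs.v *)
From mathcomp Require Import all_boot all_order all_algebra.
From mathcomp Require Import boolp.
From mathcomp Require Import mpoly.

Set Implicit Arguments.
Unset Strict Implicit.
Unset Printing Implicit Defensive.

Import GRing.Theory.
Local Open Scope ring_scope.

Record sgraph (V : finType) := SGraph {
  edge : rel V;
  edge_sym : ssrbool.symmetric edge;
  edge_irr : irreflexive edge
}.

Definition connected_graph (V : finType) (G : sgraph V) : Prop :=
  forall u w : V, connect (edge G) u w.

Definition complete_graph (V : finType) (G : sgraph V) : Prop :=
  forall u w : V, u != w -> edge G u w.

(* The cone vertex v is [None]; a vertex u of H becomes [Some u]. *)
Definition cone_edge (V : finType) (H : sgraph V) : rel (option V) :=
  fun a b => match a, b with
  | Some u, Some w => edge H u w
  | None, None => false
  | _, _ => true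
  end.

Lemma cone_edge_sym (V : finType) (H : sgraph V) : ssrbool.symmetric (cone_edge H).
Proof. by case=> [u|] [w|] //=; apply: edge_sym. Qed.

Lemma cone_edge_irr (V : finType) (H : sgraph V) : irreflexive (cone_edge H).
Proof. by case=> [u|] //=; apply: edge_irr. Qed.

Definition cone (V : finType) (H : sgraph V) : sgraph (option V) :=
  SGraph (cone_edge_sym H) (cone_edge_irr H).

Section Ideals.
Variable R : comNzRingType.
Implicit Types (I P G m : {pred R}).

Definition ideal_gen G : {pred R} :=
  [pred f | `[< exists s : seq (R * R),
     {in s, forall p, p.2 \in G} /\ f = \sum_(p <- s) p.1 * p.2 >]].

(* [idealr_closed] includes properness. *)
Definition prime_ideal P : Prop := idealr_closed P /\ prime_idealr_closed P.

Definition is_max (Q : nat -> Prop) (d : nat) : Prop :=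
  Q d /\ forall e, Q e -> (e <= d)%N.

(* Primes of R / I are identified with the primes of R containing I. *)
Definition prime_chain I (d : nat) : Prop :=
  exists P : nat -> {pred R},
    (forall i, (i <= d)%N -> prime_ideal (P i) /\ {subset I <= P i}) /\
    (forall i, (i < d)%N ->
       {subset P i <= P i.+1} /\ ~ {subset P i.+1 <= P i}).

Definition is_dim I (d : nat) : Prop := is_max (prime_chain I) d.

(* The sequence s of R is regular on the R-module R / I: each s`_i is a
   nonzerodivisor on R / (I + (s_0, ..., s_(i-1))), and R / (I + (s)) <> 0. *)
Definition regular_seq I (s : seq R) : Prop :=
  (forall i, (i < size s)%N -> forall g,
     s`_i * g \in ideal_gen [predU I & take i s] ->
     g \in ideal_gen [predU I & take i s]) /\
  1 \notin ideal_gen [predU I & s].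

Definition is_depth m I (d : nat) : Prop :=
  is_max (fun l => exists s : seq R,
            [/\ size s = l, {subset s <= m} & regular_seq I s]) d.

(* Since depth <= dim, the defect is a natural number. *)
Definition is_cmdef m I (c : nat) : Prop :=
  exists d t : nat, [/\ is_dim I d, is_depth m I t & d = (t + c)%N].

End Ideals.

Section BinomialEdgeIdeal.
Variables (K : fieldType) (V : finType).

(* K[x_u, y_u : u in V]: the variables are indexed by V + V, with x_u on the
   left and y_u on the right. *)
Local Notation vring := {mpoly K[#|{: V + V}|]}.

Definition xvar (u : V) : vring := 'X_(enum_rank (inl u : V + V)%type).
Definition yvar (u : V) : vring := 'X_(enum_rank (inr u : V + V)%type).

Definition graded_max_ideal : {pred vring} := [pred f : vring | f@_0%MM == 0].

Definition edge_binomials (G : sgraph V) : {pred vring} :=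
  [pred f : vring | [exists u, exists w,
     edge G u w && (f == xvar u * yvar w - xvar w * yvar u)]].

Definition binomial_edge_ideal (G : sgraph V) : {pred vring} :=
  ideal_gen (edge_binomials G).

Definition graph_depth (G : sgraph V) (d : nat) : Prop :=
  is_depth graded_max_ideal (binomial_edge_ideal G) d.

Definition cohen_macaulay (G : sgraph V) : Prop :=
  is_cmdef graded_max_ideal (binomial_edge_ideal G) 0.

Definition almost_cohen_macaulay (G : sgraph V) : Prop :=
  is_cmdef graded_max_ideal (binomial_edge_ideal G) 1.

End BinomialEdgeIdeal.

(* Main.v *)
From HB Require Import structures.
Require Import Defs.
From mathcomp Require Import all_boot all_order all_algebra.
From mathcomp Require Import boolp.
From mathcomp Require Import mpoly.
From mathcomp Require Import ring zify.

(* Let J_K be the ideal of all the 2-minors (the binomial edge ideal of the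
   complete graph on the cone) and Q = (x_v, y_v) + J_H.  Then J_G is the
   intersection of J_K and Q, so that L = J_K / J_G is isomorphic to
   (J_K + Q) / Q, a submodule of S / Q = S_H / J_H.  The cokernels S / J_K and
   S / (J_K + Q) are determinantal rings of depth n + 2 and n + 1, hence for
   k <= n + 1 each of depth(S / J_G) >= k and depth(S_H / J_H) >= k is
   equivalent to depth(L) >= k, and it remains to see that depth(L) < n + 2.

   Depth is measured by the vanishing of Koszul cohomology.  Let c belong to a
   minimal separating set X of H, let U be the complement of X and g a power of
   the product of the x_k for k in U.  The 2-cochain (y_i, y_j) |-> g (y_i x_j -
   y_j x_i) on the variables y is a cocycle with values in L, killed by a power
   of x_c since the graph induced on U + c is connected and dominating.  It is
   not a coboundary: at the point x = 1, y = t on one component of U and x = 1,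
   y = 0 on the others, the value at some y_j of a 1-cochain bounding it would be
   1, while J_K + Q vanishes when t = 0.  So some H^i
   with i <= 2 of L on x_c and the y_i is not zero.  Each of the n - 1 other
   x_k raises the degree of the first nonvanishing cohomology group by at most
   one, by Nakayama.

   For the second statement, a chain of primes over J_G starts over J_K or over
   Q; the latter are chains over J_H, and the former have length at most n + 2,
   as S / J_K embeds in a polynomial ring in n + 2 variables. *)

Set Implicit Arguments.
Unset Strict Implicit.
Unset Printing Implicit Defensive.

Import GRing.Theory.
Local Open Scope ring_scope.

(** * Ideals and Koszul cohomology *)

Section IdealBasics.
Variable R : comNzRingType.
Implicit Types (I J N B G : {pred R}) (z r : seq R).

(** Unlike [idealr_closed], this admits the unit ideal, so that the whole ring [predT] can serve as
    the numerator N of a quotient N / B. *)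
Definition is_ideal I : Prop :=
  0 \in I /\ forall a x y, x \in I -> y \in I -> a * x + y \in I.

Section Closure.
Variables (I : {pred R}) (idI : is_ideal I).

Lemma ideal0 : 0 \in I. Proof. by case: idI. Qed.

Lemma idealD x y : x \in I -> y \in I -> x + y \in I.
Proof. by move=> xI yI; have := idI.2 1 x y xI yI; rewrite mul1r. Qed.

Lemma ideal_mull a x : x \in I -> a * x \in I.
Proof. by move=> xI; have := idI.2 a x 0 xI ideal0; rewrite addr0. Qed.

Lemma ideal_mulr a x : x \in I -> x * a \in I.
Proof. by rewrite mulrC; apply: ideal_mull. Qed.

Lemma idealN x : x \in I -> - x \in I.
Proof. by rewrite -mulN1r; apply: ideal_mull. Qed.

Lemma idealB x y : x \in I -> y \in I -> x - y \in I.
Proof. by move=> xI yI; apply: idealD => //; apply: idealN. Qed.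

Lemma ideal_sum (T : Type) (s : seq T) (P : pred T) (F : T -> R) :
  (forall i, P i -> F i \in I) -> \sum_(i <- s | P i) F i \in I.
Proof.
move=> FI; apply: (big_ind (fun x => x \in I)) => //; [exact: ideal0 | exact: idealD].
Qed.

Lemma ideal_sum_seq (T : eqType) (s : seq T) (F : T -> R) :
  {in s, forall i, F i \in I} -> \sum_(i <- s) F i \in I.
Proof. by move=> FI; rewrite big_seq_cond; apply: ideal_sum => i /andP[/FI]. Qed.

Lemma ideal_eqmod x y : x - y \in I -> y \in I -> x \in I.
Proof. by move=> h yI; rewrite -(subrK y x); apply: idealD. Qed.

Lemma ideal_eqmod' x y : x - y \in I -> x \in I -> y \in I.
Proof. by move=> h xI; rewrite -(subKr x y); apply: idealB. Qed.

End Closure.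

Lemma ideal_genP G f :
  reflect (exists s : seq (R * R),
     {in s, forall p, p.2 \in G} /\ f = \sum_(p <- s) p.1 * p.2)
    (f \in ideal_gen G).
Proof. exact: asboolP. Qed.

Lemma mem_ideal_gen G f : f \in G -> f \in ideal_gen G.
Proof.
move=> fG; apply/ideal_genP; exists [:: (1, f)]; split.
  by move=> p; rewrite inE => /eqP ->.
by rewrite big_seq1 mul1r.
Qed.

Lemma ideal_gen_ideal G : is_ideal (ideal_gen G).
Proof.
split; first by apply/ideal_genP; exists [::]; rewrite big_nil.
move=> a x y /ideal_genP[s [sG ->]] /ideal_genP[t [tG ->]].
apply/ideal_genP; exists ([seq (a * p.1, p.2) | p <- s] ++ t); split.
  move=> p; rewrite mem_cat => /orP[|/tG //].
  by case/mapP=> q qs -> /=; apply: sG.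
rewrite big_cat big_map mulr_sumr /=; congr (_ + _).
by apply: eq_bigr => p _; rewrite mulrA.
Qed.

Lemma ideal_gen_sub G I :
  is_ideal I -> {subset G <= I} -> {subset ideal_gen G <= I}.
Proof.
move=> idI GI f /ideal_genP[s [sG ->]].
by apply: ideal_sum_seq => // p /sG /GI; apply: ideal_mull.
Qed.

Lemma ideal_gen_mono G G' : {subset G <= G'} -> {subset ideal_gen G <= ideal_gen G'}.
Proof.
move=> GG'; apply: ideal_gen_sub; first exact: ideal_gen_ideal.
by move=> f /GG'; apply: mem_ideal_gen.
Qed.

Definition ideal_add I J : {pred R} := ideal_gen [predU I & J].

Lemma ideal_add_ideal I J : is_ideal (ideal_add I J).
Proof. exact: ideal_gen_ideal. Qed.

Lemma ideal_addl I J : {subset I <= ideal_add I J}.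
Proof. by move=> x xI; apply: mem_ideal_gen; rewrite inE xI. Qed.

Lemma ideal_addr I J : {subset J <= ideal_add I J}.
Proof. by move=> x xI; apply: mem_ideal_gen; rewrite inE xI orbT. Qed.

Lemma ideal_addP I J x : is_ideal I -> is_ideal J ->
  x \in ideal_add I J -> exists2 y, y \in I & x - y \in J.
Proof.
move=> idI idJ /ideal_genP[s [sIJ ->]].
elim: s sIJ => [|p s IH] sIJ.
  by exists 0; [apply: ideal0 | rewrite big_nil subr0; apply: ideal0].
have [|y yI hJ] := IH; first by move=> q qs; apply: sIJ; rewrite inE qs orbT.
have := sIJ p (mem_head _ _); rewrite !inE big_cons => /orP[] hp.
  exists (p.1 * p.2 + y); first by apply: idealD => //; apply: ideal_mull.
  by rewrite opprD addrACA subrr add0r.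
exists y => //; rewrite -addrA; apply: idealD => //; exact: ideal_mull.
Qed.

Lemma ideal_setT : is_ideal predT. Proof. by []. Qed.

Lemma ideal_setI I J : is_ideal I -> is_ideal J -> is_ideal [predI I & J].
Proof.
move=> idI idJ; split; first by rewrite inE !ideal0.
move=> a x y; rewrite !inE => /andP[xI xJ] /andP[yI yJ].
by rewrite idI.2 ?idJ.2.
Qed.

Definition ideal_span z : {pred R} := ideal_gen [pred x | x \in z].

Definition dot r z : R := \sum_(p <- zip r z) p.1 * p.2.

Lemma dot_cons a r b z : dot (a :: r) (b :: z) = a * b + dot r z.
Proof. by rewrite /dot /= big_cons. Qed.

Lemma dot_nil : dot [::] [::] = 0. Proof. by rewrite /dot big_nil. Qed.

Lemma dot_nseq0 z : dot (nseq (size z) 0) z = 0.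
Proof.
by elim: z => [|a z IH]; rewrite ?dot_nil //= dot_cons IH mul0r addr0.
Qed.

Lemma ideal_dot I r z : is_ideal I -> {subset z <= I} -> dot r z \in I.
Proof.
move=> idI zI; apply: ideal_sum_seq => // -[a b] /= h; apply: ideal_mull => //.
apply: zI; elim: r z h => [|a' r IH] [|b' z] //=.
rewrite !inE => /orP[/eqP[_ ->]|/IH ->]; by rewrite ?eqxx ?orbT.
Qed.

Lemma ideal_gen_dotP z f : f \in ideal_span z ->
  exists2 r, size r = size z & f = dot r z.
Proof.
case/ideal_genP=> s [sz ->]; elim: s sz => [|p s IH] sz.
  by exists (nseq (size z) 0); rewrite ?size_nseq // big_nil dot_nseq0.
have [|r szr er] := IH; first by move=> q qs; apply: sz; rewrite inE qs orbT.
have pz: p.2 \in z by apply: sz; rewrite mem_head.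
rewrite big_cons {}er; elim: z r szr pz {IH sz} => [|b z IH] [|a r] //= [szr].
rewrite inE => /orP[/eqP->|/(IH _ szr)[r' sr' er']].
  by exists (p.1 + a :: r) => /=; rewrite ?szr // !dot_cons mulrDl addrA.
by exists (a :: r') => /=; rewrite ?sr' // !dot_cons addrCA er'.
Qed.

End IdealBasics.

Lemma ker_ideal (R A : comNzRingType) (F : {rmorphism R -> A}) :
  is_ideal [pred f | F f == 0].
Proof.
split; first by rewrite inE rmorph0.
move=> a x y; rewrite !inE rmorphD rmorphM => /eqP-> /eqP->.
by rewrite mulr0 addr0.
Qed.

Lemma ker_prime (R : comNzRingType) (A : idomainType) (F : {rmorphism R -> A}) f g :
  F (f * g) == 0 -> F f != 0 -> F g == 0.
Proof. by rewrite rmorphM mulf_eq0 => /orP[->|->]. Qed.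

Section Koszul.
Variable R : comNzRingType.
Implicit Types (I J N B G : {pred R}) (z r : seq R) (c b : seq bool -> R).
Implicit Types (s t : seq bool).

(* A Koszul cochain of degree i on z_1, ..., z_r is a function on bit strings
   of size r, only its values on strings with i true bits being relevant; the
   complex on a :: z is the cone of multiplication by a on the complex on z. *)
Fixpoint kd z c s : R :=
  match z, s with
  | a :: z', false :: s' => kd z' (fun t => c (false :: t)) s'
  | a :: z', true :: s' => a * c (false :: s') - kd z' (fun t => c (true :: t)) s'
  | _, _ => 0
  end.

(* The homotopy contracting multiplication by [dot r z]. *)
Fixpoint kh r c s : R :=
  match r, s with
  | a :: r', false :: s' => a * c (true :: s') + kh r' (fun t => c (false :: t)) s'
  | a :: r', true :: s' => - kh r' (fun t => c (true :: t)) s'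
  | _, _ => 0
  end.

Lemma eq_kd z c c' s : c =1 c' -> kd z c s = kd z c' s.
Proof. by move/funext->. Qed.

Lemma eq_kh r c c' s : c =1 c' -> kh r c s = kh r c' s.
Proof. by move/funext->. Qed.

Lemma kd_lin z a c c' s :
  kd z (fun t => a * c t + c' t) s = a * kd z c s + kd z c' s.
Proof.
elim: z c c' s => [|b z IH] c c' [|[] s] /=; rewrite ?mulr0 ?addr0 //=.
by rewrite IH; ring.
Qed.

Lemma kh_lin r a c c' s :
  kh r (fun t => a * c t + c' t) s = a * kh r c s + kh r c' s.
Proof.
elim: r c c' s => [|b z IH] c c' [|[] s] /=; rewrite ?mulr0 ?addr0 //= IH; ring.
Qed.

Lemma kd0 z s : kd z (fun=> 0) s = 0.
Proof.
elim: z s => [|b z IH] [|[] s] //=; by rewrite IH mulr0 subr0.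
Qed.

Lemma kh0 z s : kh z (fun=> 0) s = 0.
Proof.
elim: z s => [|b z IH] [|[] s] //=; rewrite ?IH ?mulr0 ?addr0 ?oppr0 //.
Qed.

Lemma kdZ z a c s : kd z (fun t => a * c t) s = a * kd z c s.
Proof.
rewrite -[RHS]addr0 -[X in _ + X](kd0 z s) -kd_lin.
by apply: eq_kd => t; rewrite addr0.
Qed.

Lemma kdD z c c' s : kd z (fun t => c t + c' t) s = kd z c s + kd z c' s.
Proof.
rewrite -[X in X + _]mul1r -kd_lin.
by apply: eq_kd => t; rewrite mul1r.
Qed.

Lemma kdN z c s : kd z (fun t => - c t) s = - kd z c s.
Proof. by rewrite -mulN1r -kdZ; apply: eq_kd => t; rewrite mulN1r. Qed.

Lemma kdB z c c' s : kd z (fun t => c t - c' t) s = kd z c s - kd z c' s.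
Proof. by rewrite kdD kdN. Qed.

Lemma khN r c s : kh r (fun t => - c t) s = - kh r c s.
Proof.
rewrite -mulN1r -[RHS]addr0 -[X in _ + X](kh0 r s) -kh_lin.
by apply: eq_kh => t; rewrite mulN1r addr0.
Qed.

Lemma khB r a c c' s :
  kh r (fun t => a * c t - c' t) s = a * kh r c s - kh r c' s.
Proof. by rewrite kh_lin khN. Qed.

Lemma kdK z c s : kd z (kd z c) s = 0.
Proof.
elim: z c s => [|a z IH] c [|[] s] //=.
have e : kd z (fun t => kd z (fun t => c (true :: t)) t) s = 0 by apply: IH.
by rewrite kdB kdZ e subr0 subrr.
Qed.

(** Contraction with [r] is a homotopy between 0 and multiplication by [dot r z], so the ideal
    generated by [z] annihilates Koszul cohomology. In the inductive step the cross terms of the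
    cone cancel. *)
Lemma kd_kh r z c s : size r = size z -> size s = size z ->
  kd z (kh r c) s + kh r (kd z c) s = dot r z * c s.
Proof.
elim: z r c s => [|a z IH] [|r0 r] c [|[] s] //=.
- by rewrite dot_nil mul0r addr0.
- move=> [sr] [ss]; rewrite dot_cons.
  rewrite khB kdN; have := IH r (fun t => c (true :: t)) s sr ss.
  set X := kd z _ s; set Y := kh r _ s; move=> h.
  rewrite mulrDl -h; ring.
- move=> [sr] [ss]; rewrite dot_cons.
  by rewrite kd_lin mulrDl -(IH r (fun t => c (false :: t))) //; ring.
Qed.

(** [kd] reads [c] only on strings with one true bit fewer, so a cochain may be changed freely in
    the other degrees; the truncated cochains below rely on this. *)
Lemma kd_mem B z c s : is_ideal B -> size s = size z ->
  (forall t, size t = size z -> (count id t).+1 = count id s -> c t \in B) ->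
  kd z c s \in B.
Proof.
move=> idB; elim: z c s => [|a z IH] c [|[] s] //=; try by move=> *; apply: ideal0.
  move=> [ss] h; apply: idealB => //.
    by apply: ideal_mull => //; apply: h; rewrite /= ?ss ?add0n ?add1n.
  by apply: IH => // t st ct; apply: h; rewrite /= ?st ?add1n ?ct.
by move=> [ss] h; apply: IH => // t st ct; apply: h; rewrite /= ?st ?add0n.
Qed.

Lemma ideal_zero : is_ideal (pred1 (0 : R)).
Proof.
split; first by rewrite inE.
by move=> a x y; rewrite !inE => /eqP -> /eqP ->; rewrite mulr0 addr0.
Qed.

Lemma eq_kd_deg z c c' s : size s = size z ->
  (forall t, size t = size z -> (count id t).+1 = count id s -> c t = c' t) ->
  kd z c s = kd z c' s.
Proof.
move=> ss h; apply/eqP; rewrite -subr_eq0 -kdB.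
by apply: (kd_mem ideal_zero ss) => t st /(h t st) ->; rewrite inE subrr.
Qed.

Lemma kh_mem B r c s : is_ideal B -> size s = size r ->
  (forall t, size t = size r -> count id t = (count id s).+1 -> c t \in B) ->
  kh r c s \in B.
Proof.
move=> idB; elim: r c s => [|a z IH] c [|[] s] //=; try by move=> *; apply: ideal0.
  move=> [ss] h; apply: idealN => //.
  by apply: IH => // t st ct; apply: h; rewrite /= ?st ?add1n ?ct.
move=> [ss] h; apply: idealD => //.
  by apply: ideal_mull => //; apply: h; rewrite /= ?ss ?add0n ?add1n.
by apply: IH => // t st ct; apply: h; rewrite /= ?st ?add0n.
Qed.

Lemma kd_mem_all B z c s : is_ideal B -> (forall t, c t \in B) -> kd z c s \in B.
Proof.
move=> idB; elim: z c s => [|a z IH] c [|[] s] //= h; try exact: ideal0.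
  by apply: idealB => //; [apply: ideal_mull | apply: IH].
exact: IH.
Qed.

Lemma kh_mem_all B z c s : is_ideal B -> (forall t, c t \in B) -> kh z c s \in B.
Proof.
move=> idB; elim: z c s => [|a z IH] c [|[] s] //= h; try exact: ideal0.
  by apply: idealN => //; apply: IH.
by apply: idealD => //; [apply: ideal_mull | apply: IH].
Qed.

Lemma kd_deg0 z c s : count id s = 0%N -> kd z c s = 0.
Proof.
by elim: z c s => [|a z IH] c [|[] s] //= si; apply: IH.
Qed.

(** Cochains with values in N / B are represented by lifts to N. Membership in N is imposed on every
    string, the congruence modulo B only in the relevant degree. *)
Definition kcocycle z B N i c : Prop :=
  (forall s, c s \in N) /\
  (forall s, size s = size z -> count id s = i.+1 -> kd z c s \in B).

Definition kcobound z B N i c : Prop :=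
  exists2 b, (forall s, b s \in N) &
    (forall s, size s = size z -> count id s = i -> c s - kd z b s \in B).

(* [H^i(z; N / B) = 0] for all [i < k]. *)
Definition kdepth z B N k : Prop :=
  forall i c, (i < k)%N -> kcocycle z B N i c -> kcobound z B N i c.

Lemma kdepth0 z B N : kdepth z B N 0. Proof. by []. Qed.

Lemma kdepthW z B N k l : (l <= k)%N -> kdepth z B N k -> kdepth z B N l.
Proof. by move=> lk h i c il; apply: h; apply: leq_trans lk. Qed.

(* [f] acts as zero on the Koszul cohomology as soon as it belongs to
   [(z) + ann (N / B)]. *)
Definition kkills z B N (f : R) : Prop :=
  exists2 r, size r = size z & forall x, x \in N -> (f - dot r z) * x \in B.

Lemma kkills_gen z B N f : is_ideal B -> f \in ideal_span z -> kkills z B N f.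
Proof.
move=> idB /ideal_gen_dotP[r sr ->]; exists r => // x _.
by rewrite subrr mul0r; apply: ideal0.
Qed.

Lemma kkills_ann z B N f : (forall x, x \in N -> f * x \in B) -> kkills z B N f.
Proof.
move=> h; exists (nseq (size z) 0); first by rewrite size_nseq.
by move=> x xN; rewrite dot_nseq0 subr0; apply: h.
Qed.

(** The bounding cochain is [kh r c]: by [kd_kh] the error is [(f - dot r z) * c s], in B by
    assumption, plus [kh r (kd z c) s], in B since [c] is a cocycle. *)
Lemma kkills_cobound z B N i f c : is_ideal B -> is_ideal N ->
  kkills z B N f -> kcocycle z B N i c -> kcobound z B N i (fun t => f * c t).
Proof.
move=> idB idN [r sr hr] [cN cd]; exists (kh r c).
  by move=> s; apply: kh_mem_all.
move=> s ss si.
have -> : f * c s - kd z (kh r c) s = (f - dot r z) * c s + kh r (kd z c) s.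
  by rewrite mulrBl -(kd_kh c sr ss); ring.
apply: idealD => //; first exact: hr.
apply: kh_mem => //; first by rewrite sr.
by move=> t; rewrite sr si => st ti; apply: cd.
Qed.

(** In the long exact sequence of the cone of a, H^i(a :: z) maps onto the kernel of a on H^i(z); if
    it vanishes, a is injective there. *)
Lemma kdepth_cons_inj a z B N k i c : is_ideal B -> is_ideal N ->
  kdepth (a :: z) B N k -> (i < k)%N -> kcocycle z B N i c ->
  kcobound z B N i (fun t => a * c t) -> kcobound z B N i c.
Proof.
move=> idB idN h ik [cN cd] [b bN bP].
(* A cochain [b] bounding [a * c] and [c] itself together form a cocycle on [a :: z]. *)
have [|e eN eP] := h i (fun s => if s is true :: t then b t else c (behead s)) ik.
  split; first by case=> [|[] s].
  case=> [|[] s] //= [ss] si; last exact: cd.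
  by apply: bP => //; case: si.
exists (fun t => e (false :: t)) => // s ss si.
by have /= := eP (false :: s); apply => //; rewrite ss.
Qed.

(** For i < k, multiplication by a on H^i(z; N / B) is injective by the cone sequence and zero by
    assumption. *)
Lemma kdepth_behead a z B N k : is_ideal B -> is_ideal N ->
  kkills z B N a -> kdepth (a :: z) B N k -> kdepth z B N k.
Proof.
move=> idB idN ka h i c ik cc.
apply: (kdepth_cons_inj idB idN h ik cc).
exact: kkills_cobound.
Qed.

(** The other half of the cone sequence: the cokernel of a on H^i(z) embeds into H^(i+1)(a :: z), so
    a is onto when the latter vanishes. *)
Lemma kdepth_cons_surj a z B N k i c : is_ideal B -> is_ideal N ->
  kdepth (a :: z) B N k.+1 -> (i < k)%N -> kcocycle z B N i c ->
  exists e f, [/\ kcocycle z B N i e, (forall s, f s \in N) &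
    forall s, size s = size z -> count id s = i ->
      c s - (a * e s + kd z f s) \in B].
Proof.
move=> idB idN h ik [cN cd].
have [|e eN eP] := h i.+1 (fun s => if s is true :: t then c t else 0) ik.
  split; first by case=> [|[] s] //; apply: ideal0.
  case=> [|[] s] //= [ss]; last by rewrite kd0 => _; apply: ideal0.
  case=> si; rewrite mulr0 sub0r; apply: idealN => //; exact: cd.
exists (fun t => e (false :: t)), (fun t => - e (true :: t)); split.
- split=> // s ss si; have := eP (false :: s); rewrite /= ss => /(_ erefl si).
  by rewrite sub0r => /(idealN idB); rewrite opprK.
- by move=> s; apply: idealN.
- move=> s ss si; have := eP (true :: s); rewrite /= ss si => /(_ erefl erefl).
  by rewrite kdN.
Qed.

(** The middle term of the long exact sequence of 0 -> J / I -> N / I -> N / J -> 0. *)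
Lemma kdepth_ext z I J N k : is_ideal I -> is_ideal J -> is_ideal N ->
  {subset I <= J} -> {subset J <= N} ->
  kdepth z I J k -> kdepth z J N k -> kdepth z I N k.
Proof.
move=> idI idJ idN IJ JN h1 h2 i c ik [cN cd].
have [|b bN bP] := h2 i c ik; first by split=> // s ss si; apply/IJ/cd.
(* Corrected by a coboundary, [c] takes values in J, but only in degree i; elsewhere it is replaced
   by 0. *)
pose c' s := if (size s == size z) && (count id s == i) then c s - kd z b s else 0.
have [|e eN eP] := h1 i c' ik.
  split=> [s|s ss si].
    rewrite /c'; case: ifP => [/andP[/eqP ss /eqP si]|_]; first exact: bP.
    exact: ideal0.
  have -> : kd z c' s = kd z (fun t => c t - kd z b t) s.
    by apply: eq_kd_deg => // t st; rewrite si => -[ti]; rewrite /c' st ti !eqxx.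
  by rewrite kdB kdK subr0; apply: cd.
exists (fun t => b t + e t); first by move=> s; apply: idealD => //; apply/JN.
move=> s ss si; have := eP s ss si; rewrite /c' ss si !eqxx /= kdD.
by rewrite opprD addrA.
Qed.

(** The left term of the same sequence: H^(i+1)(J / I) sits between H^i(N / J) and H^(i+1)(N / I),
    which is why N / J may have one degree less. *)
Lemma kdepth_sub z I J N k : is_ideal I -> is_ideal J -> is_ideal N ->
  {subset I <= J} -> {subset J <= N} ->
  kdepth z I N k.+1 -> kdepth z J N k -> kdepth z I J k.+1.
Proof.
move=> idI idJ idN IJ JN h1 h2 i c ik [cJ cd].
have [|b bN bP] := h1 i c ik; first by split=> // s; apply/JN.
(* In degree 0 coboundaries are zero, so [c] is already in I. *)
case: i ik cd bP => [|i] ik cd bP.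
  exists (fun=> 0); first by move=> s; apply: ideal0.
  move=> s ss si; rewrite kd0 subr0; have := bP s ss si.
  by rewrite kd_deg0 ?subr0.
(* [b] is a cocycle modulo J; subtracting a coboundary moves it into J and does not change
   [kd z b]. *)
have [|e eN eP] := h2 i b ik.
  split=> // s ss si; apply: (ideal_eqmod' idJ (x := c s)) => //.
  by apply: IJ; apply: bP.
pose j s := if (size s == size z) && (count id s == i) then b s - kd z e s else 0.
exists j.
  move=> s; rewrite /j; case: ifP => [/andP[/eqP ss /eqP si]|_]; first exact: eP.
  exact: ideal0.
move=> s ss si.
have -> : kd z j s = kd z (fun t => b t - kd z e t) s.
  by apply: eq_kd_deg => // t st; rewrite si => -[ti]; rewrite /j st ti !eqxx.
by rewrite kdB kdK subr0; apply: bP.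
Qed.

(** J modulo its intersection with Q is isomorphic to (J + Q) / Q; cochains are transported by
    choosing representatives in J. *)
Lemma kdepth_iso z J Q k : is_ideal J -> is_ideal Q ->
  kdepth z Q (ideal_add J Q) k -> kdepth z [predI J & Q] J k.
Proof.
move=> idJ idQ h i c ik [cJ cd].
have [|b bN bP] := h i c ik.
  split=> [s|s ss si]; first exact: ideal_addl.
  by have := cd s ss si; rewrite inE => /andP[].
have : forall s, exists b1 : R, b1 \in J /\ b s - b1 \in Q.
  by move=> s; have [y yJ yQ] := ideal_addP idJ idQ (bN s); exists y.
move=> /choice[b1 b1P]; exists b1; first by move=> s; case: (b1P s).
move=> s ss si; rewrite inE; apply/andP; split.
  apply: idealB => //; apply: kd_mem_all => // t; by case: (b1P t).
have -> : c s - kd z b1 s = (c s - kd z b s) + kd z (fun t => b t - b1 t) s.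
  by rewrite kdB; ring.
apply: idealD => //; first exact: bP.
by apply: kd_mem_all => // t; case: (b1P t).
Qed.

Lemma kdepth_iso' z J Q k : is_ideal J -> is_ideal Q ->
  kdepth z [predI J & Q] J k -> kdepth z Q (ideal_add J Q) k.
Proof.
move=> idJ idQ h i c ik [cJ cd].
have : forall s, exists b1 : R, b1 \in J /\ c s - b1 \in Q.
  by move=> s; have [y yJ yQ] := ideal_addP idJ idQ (cJ s); exists y.
move=> /choice[c1 c1P].
have [|b bN bP] := h i c1 ik.
  split=> [s|s ss si]; first by case: (c1P s).
  rewrite inE; apply/andP; split.
    by apply: kd_mem_all => // t; case: (c1P t).
  apply: (ideal_eqmod' idQ _ (cd s ss si)); rewrite -kdB.
  by apply: kd_mem_all => // t; case: (c1P t).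
exists b; first by move=> s; apply: ideal_addl.
move=> s ss si; have := bP s ss si; rewrite inE => /andP[_ h1].
rewrite -(subrK (c1 s) (c s)) -addrA; apply: idealD => //.
by case: (c1P s).
Qed.

Definition regular_on I (f : R) : Prop := forall g, f * g \in I -> g \in I.

Lemma ideal_add1P I f x : is_ideal I ->
  x \in ideal_gen [predU I & [:: f]] -> exists e, x - f * e \in I.
Proof.
move=> idI /ideal_genP[l [lP ->]]; elim: l lP => [|p l IH] lP.
  by exists 0; rewrite big_nil mulr0 subr0; apply: ideal0.
have [|e eP] := IH; first by move=> q ql; apply: lP; rewrite inE ql orbT.
have := lP p (mem_head _ _); rewrite !inE big_cons => /orP[] hp.
  exists e; rewrite -addrA; apply: idealD eP => //.
  exact: ideal_mull.
exists (p.1 + e); rewrite (eqP hp).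
by have -> : p.1 * f + \sum_(j <- l) j.1 * j.2 - f * (p.1 + e) =
    \sum_(j <- l) j.1 * j.2 - f * e by ring.
Qed.

(** For a cocycle c modulo f, [kd z c] is [f * e] modulo I, and e is a cocycle because f is regular.
    If g bounds e, then [c - f * g] is a cocycle modulo I. *)
Lemma kdepth_quot z I f k : is_ideal I -> regular_on I f ->
  kdepth z I predT k.+1 -> kdepth z (ideal_gen [predU I & [:: f]]) predT k.
Proof.
move=> idI rf h i c ik [_ cd].
have idI' := ideal_gen_ideal [predU I & [:: f]].
have : forall s, exists e : R, size s = size z -> count id s = i.+1 ->
    kd z c s - f * e \in I.
  move=> s; case: (pselect (size s = size z /\ count id s = i.+1)); last first.
    by move=> n; exists 0 => s1 s2; case: n.
  move=> [s1 s2]; have := cd s s1 s2.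
  by case/(ideal_add1P idI) => e eP; exists e.
move=> /choice[e eP].
have [|g _ gP] := h i.+1 e ik.
  split=> // s ss si; apply: rf; rewrite -kdZ.
  have -> : kd z (fun t => f * e t) s = - kd z (fun t => kd z c t - f * e t) s.
    by rewrite kdB kdK sub0r opprK.
  apply: idealN => //; apply: kd_mem => // t st; rewrite si => -[ti]; exact: eP.
have [|b _ bP] := h i (fun t => c t - f * g t) (ltnW ik).
  split=> // s ss si; rewrite kdB kdZ.
  have -> : kd z c s - f * kd z g s = (kd z c s - f * e s) + f * (e s - kd z g s).
    by ring.
  by apply: idealD => //; [apply: eP | apply: ideal_mull => //; apply: gP].
exists b => // s ss si.
have -> : c s - kd z b s = (c s - f * g s - kd z b s) + g s * f by ring.
apply: idealD => //; first by apply: mem_ideal_gen; rewrite inE bP.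
by apply: ideal_mull => //; apply: mem_ideal_gen; rewrite !inE eqxx orbT.
Qed.

(** As a member of (z), f acts as zero on H^i(z; R / I), while the vanishing of H^(i-1) for the
    quotient by f makes it injective there. *)
Lemma kdepth_regular z I f k : is_ideal I -> regular_on I f ->
  f \in ideal_span z ->
  kdepth z (ideal_gen [predU I & [:: f]]) predT k -> kdepth z I predT k.+1.
Proof.
move=> idI rf fz h i c ik cc; have [_ cd] := cc.
have kf : kkills z I predT f by apply: kkills_gen.
have [b _ bP] := kkills_cobound idI (@ideal_setT _) kf cc.
case: i ik cc cd bP => [|i] ik cc cd bP.
  exists (fun=> 0) => // s ss si; rewrite kd_deg0 // subr0; apply: rf.
  by have := bP s ss si; rewrite kd_deg0 // subr0.
have [|e _ eP] := h i b ik.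
  split=> // s ss si.
  have -> : kd z b s = c s * f - (f * c s - kd z b s) by rewrite /=; ring.
  apply: idealB; first exact: ideal_gen_ideal.
    apply: ideal_mull; first exact: ideal_gen_ideal.
    by apply: mem_ideal_gen; rewrite !inE eqxx orbT.
  by apply: mem_ideal_gen; rewrite inE bP.
have : forall s, exists g, size s = size z -> count id s = i ->
    b s - kd z e s - f * g \in I.
  move=> s; case: (pselect (size s = size z /\ count id s = i)); last first.
    by move=> n; exists 0 => s1 s2; case: n.
  move=> [s1 s2]; have [g gP] := ideal_add1P idI (eP s s1 s2).
  by exists g.
move=> /choice[g gP]; exists g => // s ss si; apply: rf.
have -> : f * (c s - kd z g s) = (f * c s - kd z b s) +
    kd z (fun t => b t - kd z e t - f * g t) s.
  by rewrite !kdB kdK kdZ; ring.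
apply: idealD => //; first exact: bP.
by apply: kd_mem => // t st; rewrite si => -[ti]; apply: gP.
Qed.

End Koszul.

(** * Regular sequences over Noetherian rings *)

Section Noetherian.
Variable R : comNzRingType.
Implicit Types (I J M : {pred R}) (f g h : R).

Definition noetherian : Prop := forall I, is_ideal I ->
  exists2 s : seq R, {subset s <= I} & {subset I <= ideal_span s}.

Hypothesis noethR : noetherian.

(** Finitely many generators can be taken from G itself: expand the generators of the ideal and keep
    the elements of G that occur. *)
Lemma noetherian_gen (G : {pred R}) :
  exists2 s : seq R, {subset s <= G} & {subset G <= ideal_span s}.
Proof.
have [t tG Gt] := noethR (ideal_gen_ideal G).
suff [s sG ts] : exists2 s : seq R, {subset s <= G} & {subset t <= ideal_span s}.
  exists s => // x xG; have := Gt _ (mem_ideal_gen xG).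
  by apply: ideal_gen_sub ts _; apply: ideal_gen_ideal.
elim: t tG {Gt} => [|x t IH] tG; first by exists [::].
have [|s sG ts] := IH; first by move=> y yt; apply: tG; rewrite inE yt orbT.
have /ideal_genP[l [lG ex]] := tG x (mem_head _ _).
exists ([seq p.2 | p <- l] ++ s).
  move=> y; rewrite mem_cat => /orP[/mapP[p pl ->]|/sG //]; exact: lG.
move=> y; rewrite inE => /orP[/eqP->|/ts].
  apply/ideal_genP; exists l; split=> // p pl.
  by rewrite inE mem_cat map_f.
apply: ideal_gen_mono => w; rewrite !inE mem_cat => ->; exact: orbT.
Qed.

(** Otherwise choice gives a strictly increasing sequence [C] of members of P; its union is finitely
    generated, hence contained in some [C n]. *)
Lemma noetherian_max (P : {pred R} -> Prop) I :
  (forall J, P J -> is_ideal J) -> P I ->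
  exists M, [/\ P M, {subset I <= M} &
    forall J, P J -> {subset M <= J} -> {subset J <= M}].
Proof.
move=> Pid PI; apply: contrapT => nM.
have : forall M, exists J, P M -> {subset I <= M} ->
    [/\ P J, {subset M <= J} & ~ {subset J <= M}].
  move=> M; apply: contrapT => nJ; apply: nM; exists M.
  have [PM IM] : P M /\ {subset I <= M}.
    by split; apply: contrapT => n; apply: nJ; exists M.
  split=> // J PJ MJ; apply: contrapT => n; apply: nJ; by exists J.
move=> /choice[F FP]; pose C n := iter n F I.
have CP n : P (C n) /\ {subset I <= C n}.
  elim: n => [|n [PC IC]]; first by split.
  have [? h _] := FP _ PC IC.
  by split=> // x /IC/h.
have Cmono n m : (n <= m)%N -> {subset C n <= C m}.
  move=> /subnK <-; elim: (m - n)%N => [|k IH] x; rewrite ?add0n // => /IH xC.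
  by have [PC IC] := CP (k + n)%N; have [_ h _] := FP _ PC IC; apply: h.
pose U : {pred R} := [pred x | `[< exists n, x \in C n >]].
have idU : is_ideal U.
  split; first by apply/asboolP; exists 0%N; apply: ideal0; apply: Pid.
  move=> a x y /asboolP[n xn] /asboolP[m ym]; apply/asboolP; exists (maxn n m).
  apply: (Pid _ (CP _).1).2.
    exact: Cmono (leq_maxl _ _) _ xn.
  exact: Cmono (leq_maxr _ _) _ ym.
have [s sU Us] := noethR idU.
have [n sn] : exists n, {subset s <= C n}.
  elim: s sU {Us} => [|x s IH] sU; first by exists 0%N.
  have [|n sn] := IH; first by move=> y ys; apply: sU; rewrite inE ys orbT.
  have /asboolP[m xm] := sU x (mem_head _ _); exists (maxn n m) => y.
  rewrite inE => /orP[/eqP->|/sn]; first exact: Cmono (leq_maxr _ _) _ xm.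
  exact: Cmono (leq_maxl _ _) _.
have [PC IC] := CP n; have [_ _ []] := FP _ PC IC => x xC.
have /Us : x \in U by apply/asboolP; exists n.+1.
by apply: ideal_gen_sub => //; apply: Pid.
Qed.

Section RegularElement.
Variables (I m : {pred R}) (idI : is_ideal I) (idm : is_ideal m).

Let colon g : {pred R} := [pred x | x * g \in I].

Let colonE g x : (x \in colon g) = (x * g \in I). Proof. by rewrite inE. Qed.

Let colon_ideal g : is_ideal (colon g).
Proof.
split; first by rewrite inE mul0r ideal0.
move=> a x y; rewrite !inE => xI yI; rewrite mulrDl -mulrA; exact: idI.2.
Qed.

(* The ideals [colon g] for such [g] are the maximal associated primes of
   [R / I]. *)
Let maxann g : Prop := g \notin I /\
  forall h, h \notin I -> {subset colon g <= colon h} -> {subset colon h <= colon g}.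

(** If b g is not in I, its annihilator modulo I contains that of g, hence equals it by maximality,
    and it contains a. *)
Let maxann_prime g a b : maxann g -> a * b \in colon g -> a \notin colon g ->
  b \in colon g.
Proof.
move=> [_ gmax]; rewrite !colonE => abg nag; apply/negPn/negP => nbg; case/negP: nag.
have := gmax (b * g) nbg; rewrite -colonE; apply; last by rewrite colonE mulrA.
by move=> x; rewrite !colonE mulrCA => xg; apply: ideal_mull.
Qed.

Let maxann_above g : g \notin I ->
  exists2 h, maxann h & {subset colon g <= colon h}.
Proof.
move=> gI.
have [||M [[h hI ->] gh hmax]] := @noetherian_max
  (fun J => exists2 h, h \notin I & J = colon h) (colon g).
- by move=> _ [h _ ->]; apply: colon_ideal.
- by exists g.
exists h => //; split=> // h' h'I; apply: hmax; by exists h'.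
Qed.

(** Take a product of elements of the [colon h] that are not in [colon g]; it avoids [colon g] by
    primality. *)
Let maxann_avoid g (l : seq R) : maxann g ->
  (forall h, h \in l -> ~ {subset colon h <= colon g}) ->
  exists2 p, p \notin colon g & forall h, h \in l -> p \in colon h.
Proof.
move=> mg; elim: l => [|h l IH] hl.
  by exists 1 => //; rewrite colonE mul1r; case: mg.
have [|p pg pl] := IH; first by move=> h' h'l; apply: hl; rewrite inE h'l orbT.
have [q [qh qg]] : exists q, q \in colon h /\ q \notin colon g.
  apply: contrapT => n; apply: (hl h (mem_head _ _)) => q qh.
  by apply/negPn/negP => qg; apply: n; exists q.
exists (p * q).
  by apply/negP => /(maxann_prime mg) /(_ pg); rewrite (negbTE qg).
move=> h'; rewrite inE => /orP[/eqP->|/pl]; first exact: ideal_mull.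
by move=> ph; apply: ideal_mulr.
Qed.

(** Prime avoidance over a finite list of maximal annihilators, none of which contains m by
    assumption. *)
Lemma exists_regular :
  (forall g, (forall a, a \in m -> a * g \in I) -> g \in I) ->
  exists2 f, f \in m & regular_on I f.
Proof.
move=> depth1.
have [l lmax maxl] := noetherian_gen [pred g | `[< maxann g >]].
have {}lmax g : g \in l -> maxann g by move=> /lmax /asboolP.
(* Otherwise some [p] outside [colon h] kills all of [l] modulo I, hence also h, which is a
   combination of [l]. *)
have below h : maxann h -> exists2 g, g \in l & {subset colon g <= colon h}.
  move=> mh; apply: contrapT => n.
  have [|p ph pl] := maxann_avoid (l := l) mh.
    by move=> g gl gh; apply: n; exists g.
  case/negP: ph; rewrite colonE.
  have : h \in ideal_span l by apply: maxl; apply/asboolP.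
  case/ideal_genP=> s [sl ->]; rewrite mulr_sumr; apply: ideal_sum_seq => // q qs.
  by rewrite mulrCA; apply: ideal_mull => //; rewrite -colonE; apply/pl/sl.
have [f fm fl] : exists2 f, f \in m & forall g, g \in l -> f \notin colon g.
  elim: l lmax {maxl below} => [|g l IH] lmax.
    by exists 0 => //; apply: ideal0.
  have [|f fm fl] := IH; first by move=> h hl; apply: lmax; rewrite inE hl orbT.
  have mg : maxann g by apply: lmax; rewrite mem_head.
  case: (boolP (f \in colon g)) => fg; last first.
    by exists f => // h; rewrite inE => /orP[/eqP->//|/fl].
  have [|p pg pl] := maxann_avoid (l := l) mg.
    move=> h hl hg.
    have mh : maxann h by apply: lmax; rewrite inE hl orbT.
    by have := fl h hl; rewrite (mh.2 g mg.1 hg f fg).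
  have [a [am ag]] : exists a, a \in m /\ a \notin colon g.
    apply: contrapT => n; case/negP: (mg.1); apply: depth1 => a am.
    by rewrite -colonE; apply/negPn/negP => na; apply: n; exists a.
  (* [p] lies in [colon h] for all h in [l] but not in [colon g], so adding [a * p] repairs [f] at g
     and changes nothing at the others. *)
  exists (f + a * p); first by apply: idealD => //; apply: ideal_mulr.
  move=> h; rewrite inE => /orP[/eqP->|hl].
    apply/negP => h1; case/negP: pg; apply: (@maxann_prime g a) => //.
    have -> : a * p = (f + a * p) - f by ring.
    exact: (idealB (colon_ideal g) h1 fg).
  apply/negP => h1; case/negP: (fl h hl).
  have -> : f = (f + a * p) - a * p by ring.
  exact: (idealB (colon_ideal h) h1 (ideal_mull (colon_ideal h) _ (pl h hl))).
exists f => // h fh; apply/negPn/negP => hI.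
have [h' mh' hh'] := maxann_above hI; have [g gl gh'] := below _ mh'.
case/negP: (fl g gl); apply: ((lmax g gl).2 h' mh'.1 gh').
by apply: hh'; rewrite colonE.
Qed.

End RegularElement.

End Noetherian.

Section RegularSequences.
Variable R : comNzRingType.
Implicit Types (I m : {pred R}) (f g : R) (s z : seq R).

Lemma ideal_gen_id I : is_ideal I -> ideal_gen [predU I & [::]] =i I.
Proof.
move=> idI x; apply/idP/idP; last by move=> xI; apply: mem_ideal_gen; rewrite inE xI.
by apply: ideal_gen_sub => // y; rewrite !inE orbF.
Qed.

Lemma ideal_gen_cons I f s : ideal_gen [predU I & f :: s] =i
  ideal_gen [predU ideal_gen [predU I & [:: f]] & s].
Proof.
move=> x; apply/idP/idP; apply: ideal_gen_sub; try exact: ideal_gen_ideal.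
  move=> y; rewrite !inE orbA => /orP[h|ys]; apply: mem_ideal_gen.
    by rewrite inE mem_ideal_gen // !inE.
  by rewrite !inE ys orbT.
move=> y; rewrite inE => /orP[|ys]; last first.
  by apply: mem_ideal_gen; rewrite !inE ys !orbT.
apply: ideal_gen_sub; first exact: ideal_gen_ideal.
by move=> {}y; rewrite !inE => h; apply: mem_ideal_gen; rewrite !inE orbA h.
Qed.

Lemma regular_seq_cons I f s : is_ideal I ->
  regular_seq I (f :: s) <->
  regular_on I f /\ regular_seq (ideal_gen [predU I & [:: f]]) s.
Proof.
move=> idI; split.
  move=> [h h1]; split.
    by move=> g; have := h 0%N isT g; rewrite /= !ideal_gen_id.
  split; last by rewrite -ideal_gen_cons.
  by move=> i si g; have := h i.+1 si g; rewrite /= !ideal_gen_cons.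
move=> [rf [h h1]]; split; last by rewrite ideal_gen_cons.
move=> [|i] si g /=; first by rewrite !ideal_gen_id //; apply: rf.
by rewrite !ideal_gen_cons; apply: h.
Qed.

Definition has_regular_seq m I k : Prop :=
  exists s : seq R, [/\ size s = k, {subset s <= m} & regular_seq I s].

Lemma has_regular_seq_kdepth z m I k : is_ideal I -> {subset m <= ideal_span z} ->
  has_regular_seq m I k -> kdepth z I predT k.
Proof.
move=> idI mz [s [<- sm rs]] {k}.
elim: s I idI sm rs => [|f s IH] I idI sm rs; first exact: kdepth0.
have [rf rs'] := (regular_seq_cons f s idI).1 rs.
apply: (kdepth_regular idI rf).
  by apply/mz/sm; rewrite mem_head.
apply: IH => //; first exact: ideal_gen_ideal.
by move=> x xs; apply: sm; rewrite inE xs orbT.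
Qed.

Lemma kd_const_mem I z g t : is_ideal I -> (forall a, a \in z -> a * g \in I) ->
  kd z (fun=> g) t \in I.
Proof.
move=> idI; elim: z t => [|a z IH] [|[] t] h //=; try exact: ideal0.
  apply: idealB => //; first by apply: h; rewrite mem_head.
  by apply: IH => b bz; apply: h; rewrite inE bz orbT.
by apply: IH => b bz; apply: h; rewrite inE bz orbT.
Qed.

(** The constant cochain g is a cocycle of degree 0, where all coboundaries vanish. *)
Lemma kdepth1 z I g : is_ideal I -> kdepth z I predT 1 ->
  (forall a, a \in z -> a * g \in I) -> g \in I.
Proof.
move=> idI h hg; have [|b _ /(_ (nseq (size z) false))] := h 0%N (fun=> g) isT.
  by split=> // s _ _; apply: kd_const_mem.
have c0 n : count id (nseq n false) = 0%N by elim: n.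
by rewrite size_nseq c0 => /(_ erefl erefl); rewrite kd_deg0 ?subr0.
Qed.

(** The sequence is built greedily: the vanishing of H^0 yields a regular element of m, and dividing
    by it costs one degree. *)
Lemma kdepth_has_regular_seq z m I k : noetherian R ->
  is_ideal I -> is_ideal m -> {subset I <= m} -> 1 \notin m -> {subset z <= m} ->
  kdepth z I predT k -> has_regular_seq m I k.
Proof.
move=> nR; elim: k I => [|k IH] I idI idm Im m1 zm hk.
  exists [::]; split=> //; split=> //.
  by rewrite ideal_gen_id //; apply: contra m1; apply: Im.
have [|f fm rf] := exists_regular nR idI idm.
  move=> g hg; apply: (kdepth1 idI (kdepthW (ltn0Sn k) hk)) => a /zm.
  exact: hg.
have [||||||s [sk sm rs]] := IH (ideal_gen [predU I & [:: f]]).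
- exact: ideal_gen_ideal.
- exact: idm.
- by apply: ideal_gen_sub => // x; rewrite !inE => /orP[/Im //|/eqP->].
- exact: m1.
- exact: zm.
- exact: kdepth_quot.
exists (f :: s); split; first by rewrite /= sk.
  by move=> x; rewrite inE => /orP[/eqP->|/sm].
by apply/regular_seq_cons.
Qed.

End RegularSequences.

(** * Hilbert's basis theorem *)

Section Hilbert.

Lemma noetherian_field (K : fieldType) : noetherian K.
Proof.
move=> I idI; case: (pselect (exists2 x, x \in I & x != 0)) => [[x xI x0]|n].
  exists [:: x]; first by move=> y; rewrite inE => /eqP->.
  move=> y _; rewrite -(divfK x0 y); apply: ideal_mull; first exact: ideal_gen_ideal.
  by apply: mem_ideal_gen; rewrite !inE.
exists [::] => // y yI; suff -> : y = 0 by apply: ideal0; apply: ideal_gen_ideal.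
by apply/eqP/negPn/negP => y0; apply: n; exists y.
Qed.

Lemma noetherian_surj (A B : comNzRingType) (F : {rmorphism A -> B}) :
  (forall b, exists a, F a = b) -> noetherian A -> noetherian B.
Proof.
move=> Fs nA I idI; pose J : {pred A} := [pred a | F a \in I].
have idJ : is_ideal J.
  split; first by rewrite inE rmorph0 ideal0.
  by move=> a x y; rewrite !inE rmorphD rmorphM; apply: idI.2.
have [s sJ Js] := nA J idJ; exists [seq F a | a <- s].
  by move=> _ /mapP[a /sJ aJ ->].
move=> b bI; have [a ab] := Fs b; subst b.
have /Js /ideal_genP[l [ls ->]] : a \in J by rewrite inE.
rewrite rmorph_sum; apply: ideal_sum_seq; first exact: ideal_gen_ideal.
move=> p pl; rewrite rmorphM; apply: ideal_mull; first exact: ideal_gen_ideal.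
by apply: mem_ideal_gen; rewrite inE map_f //; apply: ls.
Qed.

Variable A : comNzRingType.
Implicit Types (p q : {poly A}) (I : {pred {poly A}}).

(** The leading coefficients of the elements of degree d of I, together with 0. *)
Let coefs I d : {pred A} :=
  [pred a | `[< exists p, [/\ p \in I, (size p <= d.+1)%N & p`_d = a] >]].

Let coefs_ideal I d : is_ideal I -> is_ideal (coefs I d).
Proof.
move=> idI; split.
  by apply/asboolP; exists 0; rewrite size_poly0 coef0; split=> //; apply: ideal0.
move=> a x y /asboolP[p [pI sp <-]] /asboolP[q [qI sq <-]]; apply/asboolP.
exists (a%:P * p + q); split; first exact: idI.2.
  apply: leq_trans (size_polyD _ _) _; rewrite geq_max sq andbT mul_polyC.
  exact: leq_trans (size_scale_leq _ _) sp.
by rewrite coefD coefCM.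
Qed.

Let lift_coefs I (l : seq A) d : is_ideal I -> {subset l <= coefs I d} ->
  exists2 s : seq {poly A}, {subset s <= I} & forall a, a \in ideal_span l ->
    exists q, [/\ q \in ideal_span s, (size q <= d.+1)%N & q`_d = a].
Proof.
move=> idI; elim: l => [|b l IH] lI.
  exists [::] => // a /ideal_genP[r [rl ->]]; exists 0.
  rewrite size_poly0 coef0; split=> //; first by apply: ideal0; apply: ideal_gen_ideal.
  by case: r rl => [|x r] rl; rewrite ?big_nil //; have := rl x (mem_head _ _).
have [|s sI sP] := IH; first by move=> a al; apply: lI; rewrite inE al orbT.
have /asboolP[p [pI sp pb]] := lI b (mem_head _ _).
exists (p :: s); first by move=> q; rewrite inE => /orP[/eqP->|/sI].
move=> a /ideal_gen_dotP[[|c r] // [sr] ->]; rewrite dot_cons.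
have [|q [qs sq qe]] := sP (dot r l).
  apply: ideal_dot; first exact: ideal_gen_ideal.
  by move=> x xl; apply: mem_ideal_gen.
have id' := ideal_gen_ideal [pred x | x \in p :: s].
exists (c%:P * p + q); split.
- apply: id'.2; first by apply: mem_ideal_gen; rewrite !inE eqxx.
  by apply: ideal_gen_mono qs => x; rewrite !inE => ->; rewrite orbT.
- apply: leq_trans (size_polyD _ _) _; rewrite geq_max sq andbT mul_polyC.
  exact: leq_trans (size_scale_leq _ _) sp.
- by rewrite coefD coefCM pb qe.
Qed.

Theorem hilbert_basis : noetherian A -> noetherian {poly A}.
Proof.
move=> nA I idI.
have span_sub (s t : seq {poly A}) : {subset s <= t} ->
    {subset ideal_span s <= ideal_span t}.
  by move=> st; apply: ideal_gen_mono => x; rewrite !inE; apply: st.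
(* Degrees below D are treated one at a time, each with generators of its own. *)
have low D : exists2 s : seq {poly A}, {subset s <= I} &
    forall p, p \in I -> (size p <= D)%N -> p \in ideal_span s.
  elim: D => [|D [s sI sP]].
    exists [::] => // p _; rewrite leqn0 size_poly_eq0 => /eqP->.
    by apply: ideal0; apply: ideal_gen_ideal.
  have [l lI Il] := nA _ (coefs_ideal D idI).
  have [t tI tP] := lift_coefs idI lI.
  exists (s ++ t); first by move=> p; rewrite mem_cat => /orP[/sI|/tI].
  move=> p pI sp; have [|q [qt sq qe]] := tP p`_D.
    by apply: Il; apply/asboolP; exists p.
  have qI : q \in I by apply: ideal_gen_sub qt => // x; rewrite inE; apply: tI.
  rewrite -(subrK q p); apply: idealD; first exact: ideal_gen_ideal.
    apply: (span_sub s); first by move=> x xs; rewrite mem_cat xs.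
    apply: sP; first exact: idealB.
    apply/leq_sizeP => j; rewrite leq_eqVlt => /orP[/eqP<-|Dj].
      by rewrite coefB qe subrr.
    by rewrite coefB !nth_default ?subrr // ?(leq_trans sp) ?(leq_trans sq).
  by apply: (span_sub t) qt => x xs; rewrite mem_cat xs orbT.
(* The ideal of all leading coefficients is finitely generated, hence already reached in some degree
   D; above it, shifts by powers of the variable suffice. *)
pose L : {pred A} := [pred a | `[< exists d, a \in coefs I d >]].
have coefs_mono a d e : (d <= e)%N -> a \in coefs I d -> a \in coefs I e.
  move=> de /asboolP[p [pI sp <-]]; apply/asboolP; exists ('X^(e - d) * p); split.
  - exact: ideal_mull.
  - apply: leq_trans (size_polyMleq _ _) _; rewrite size_polyXn addSn /=.
    by apply: leq_trans (leq_add (leqnn _) sp) _; rewrite addnS subnK.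
  - by rewrite coefXnM ltnNge leq_subr /= subKn.
have idL : is_ideal L.
  split; first by apply/asboolP; exists 0%N; apply: ideal0; apply: coefs_ideal.
  move=> a x y /asboolP[d xd] /asboolP[e ye]; apply/asboolP; exists (maxn d e).
  apply: (coefs_ideal _ idI).2.
    exact: coefs_mono (leq_maxl _ _) xd.
  exact: coefs_mono (leq_maxr _ _) ye.
have [l lL Ll] := nA L idL.
have [D lD] : exists D, {subset l <= coefs I D}.
  elim: l lL {Ll} => [|x l IH] lL; first by exists 0%N.
  have [|D lD] := IH; first by move=> y yl; apply: lL; rewrite inE yl orbT.
  have /asboolP[d xd] := lL x (mem_head _ _); exists (maxn D d) => y.
  rewrite inE => /orP[/eqP->|/lD]; first exact: coefs_mono (leq_maxr _ _) xd.
  exact: coefs_mono (leq_maxl _ _).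
have [t tI tP] := lift_coefs idI lD.
have [s sI sP] := low D.
exists (s ++ t); first by move=> p; rewrite mem_cat => /orP[/sI|/tI].
move=> p; move: {2}(size p) (leqnn (size p)) => n.
elim: n p => [|n IH] p sp pI.
  apply: (span_sub s); first by move=> x xs; rewrite mem_cat xs.
  by apply: sP => //; apply: leq_trans sp _.
case: (leqP (size p) D) => [pD|Dp].
  apply: (span_sub s); first by move=> x xs; rewrite mem_cat xs.
  exact: sP.
have [|q [qt sq qe]] := tP p`_n.
  by apply: Ll; apply/asboolP; exists n; apply/asboolP; exists p.
have Dn : (D <= n)%N by rewrite -ltnS; apply: leq_trans sp.
have qI : q \in I by apply: ideal_gen_sub qt => // x; rewrite inE; apply: tI.
rewrite -(subrK ('X^(n - D) * q) p); apply: idealD; first exact: ideal_gen_ideal.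
  apply: IH; last by apply: idealB => //; apply: ideal_mull.
  apply/leq_sizeP => j; rewrite leq_eqVlt => /orP[/eqP<-|nj].
    by rewrite coefB coefXnM ltnNge leq_subr /= subKn // qe subrr.
  rewrite coefB coefXnM (nth_default _ (leq_trans sp nj)) sub0r.
  case: ifP => _; first by rewrite oppr0.
  rewrite nth_default ?oppr0 //; apply: leq_trans sq _.
  by rewrite ltn_subRL subnK.
apply: ideal_mull; first exact: ideal_gen_ideal.
by apply: (span_sub t) qt => x xs; rewrite mem_cat xs orbT.
Qed.

End Hilbert.

(** * Graded polynomial rings *)

Section Polynomials.
Variables (K : fieldType) (n : nat).
Implicit Types (p q : {mpoly K[n]}).

Lemma mpoly_ring_ind (P : {mpoly K[n]} -> Prop) :
  (forall c, P c%:MP) -> (forall i, P 'X_i) ->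
  (forall p q, P p -> P q -> P (p + q)) -> (forall p q, P p -> P q -> P (p * q)) ->
  forall p, P p.
Proof.
move=> PC PX PD PM; elim/mpolyind => [|c m p _ _ Pp].
  by rewrite -mpolyC0; apply/PC.
apply/PD => //; rewrite -mul_mpolyC; apply/PM; first exact/PC.
rewrite mpolyXE_id; apply: (big_ind P) => [||i _].
- by rewrite -mpolyC1; apply/PC.
- exact/PM.
- elim: (m i) => [|k IH]; first by rewrite expr0 -mpolyC1; apply/PC.
  by rewrite exprS; apply/PM.
Qed.

Lemma pihomogM d e p q : q \is e.-homog ->
  pihomog mdeg d (p * q) = if (e <= d)%N then pihomog mdeg (d - e) p * q else 0.
Proof.
move=> hq; elim/mpolyind: p => [|c m p _ _ IH].
  by rewrite mul0r !raddf0 mul0r if_same.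
rewrite mulrDl !raddfD /= IH -scalerAl !linearZ /= pihomogX.
have hm : 'X_[m] * q \is (mdeg m + e).-homog.
  by apply: dhomogM => //; rewrite dhomogX.
have [ed|de] := leqP e d; last first.
  rewrite addr0 (pihomog_ne0 _ hm) ?scaler0 // neq_ltn.
  by rewrite (leq_trans de) ?orbT ?leq_addl.
rewrite mulrDl; congr (_ + _); rewrite -scalerAl; congr (_ *: _).
have [e1|ne] := eqVneq (mdeg m) (d - e)%N.
  by rewrite pihomog_dE // -(subnK ed) -e1.
by rewrite mul0r (pihomog_ne0 _ hm) //; apply: contra ne => /eqP <-; rewrite addnK.
Qed.

Definition homogeneous_ideal (I : {pred {mpoly K[n]}}) : Prop :=
  forall f d, f \in I -> pihomog mdeg d f \in I.

Lemma homogeneous_ideal_gen (G : {pred {mpoly K[n]}}) :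
  (forall g, g \in G -> exists e, g \is e.-homog) -> homogeneous_ideal (ideal_gen G).
Proof.
move=> hG f d /ideal_genP[s [sG ->]]; rewrite raddf_sum.
apply: ideal_sum_seq; first exact: ideal_gen_ideal.
move=> p /sG pG /=; have [e he] := hG _ pG; rewrite (pihomogM _ _ he).
case: ifP => _; last by apply: ideal0; apply: ideal_gen_ideal.
by apply: ideal_mull; [apply: ideal_gen_ideal | apply: mem_ideal_gen].
Qed.

Implicit Types (z : seq {mpoly K[n]}) (B N : {pred {mpoly K[n]}}).

Lemma pihomog_kd z d c s : {in z, forall a, a \is 1.-homog} ->
  pihomog mdeg d.+1 (kd z c s) = kd z (fun t => pihomog mdeg d (c t)) s.
Proof.
elim: z c s => [|a z IH] c [|[] s] hz //=; rewrite ?raddf0 //.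
  have ha : a \is 1.-homog by apply: hz; rewrite mem_head.
  rewrite raddfB /= mulrC (pihomogM _ _ ha) /= subn1 /= mulrC IH //.
  by move=> b bz; apply: hz; rewrite inE bz orbT.
by apply: IH => b bz; apply: hz; rewrite inE bz orbT.
Qed.

Lemma pihomog_kd0 z c s : {in z, forall a, a \is 1.-homog} ->
  pihomog mdeg 0 (kd z c s) = 0.
Proof.
elim: z c s => [|a z IH] c [|[] s] hz //=; rewrite ?raddf0 //.
  have ha : a \is 1.-homog by apply: hz; rewrite mem_head.
  rewrite raddfB /= mulrC (pihomogM _ _ ha) /= sub0r IH ?oppr0 //.
  by move=> b bz; apply: hz; rewrite inE bz orbT.
by apply: IH => b bz; apply: hz; rewrite inE bz orbT.
Qed.

Lemma kcobound_sum (R : comNzRingType) (z : seq R) (B N : {pred R}) i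
    (c : nat -> seq bool -> R) m :
  is_ideal B -> is_ideal N -> (forall e, kcobound z B N i (c e)) ->
  kcobound z B N i (fun s => \sum_(e < m) c e s).
Proof.
move=> idB idN h; elim: m => [|m [b bN bP]].
  exists (fun=> 0) => [s|s ss si]; first exact: ideal0.
  by rewrite big_ord0 kd0 subr0 ideal0.
have [b' bN' bP'] := h m.
exists (fun s => b s + b' s) => [s|s ss si]; first exact: idealD.
rewrite big_ord_recr /= kdD opprD addrACA; apply: idealD => //.
  exact: bP.
exact: bP'.
Qed.

(* Nakayama: multiplication by [a] is onto on [H^i(z; N / B)], which is graded
   and bounded below. *)
Lemma kdepth_nakayama a z B N k : is_ideal B -> is_ideal N ->
  homogeneous_ideal B -> homogeneous_ideal N ->
  {in a :: z, forall b, b \is 1.-homog} ->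
  kdepth (a :: z) B N k.+1 -> kdepth z B N k.
Proof.
move=> idB idN hB hN hz h i c ik cc.
have ha : a \is 1.-homog by apply: hz; rewrite mem_head.
have {}hz : {in z, forall b, b \is 1.-homog}.
  by move=> b bz; apply: hz; rewrite inE bz orbT.
(* By induction on e: modulo B and up to a coboundary, the component of degree e + 1 of [c] is a
   times the component of degree e of another cocycle [c1], and the component of degree 0
   vanishes. *)
have comp e : kcobound z B N i (fun t => pihomog mdeg e (c t)).
  elim: e c cc => [|e IH] c cc.
    have [c1 [f [cc1 fN cf]]] := kdepth_cons_surj idB idN h ik cc.
    exists (fun=> 0) => [s|s ss si]; first exact: ideal0.
    rewrite kd0; have /hB := cf s ss si; move=> /(_ 0%N).
    by rewrite raddfB raddfD /= mulrC (pihomogM _ _ ha) pihomog_kd0 // addr0.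
  have [c1 [f [cc1 fN cf]]] := kdepth_cons_surj idB idN h ik cc.
  have [b bN bP] := IH c1 cc1.
  exists (fun t => a * b t + pihomog mdeg e (f t)).
    by move=> s; apply: idN.2 => //; apply: hN.
  move=> s ss si; have /hB := cf s ss si; move=> /(_ e.+1).
  rewrite raddfB raddfD /= (mulrC a) (pihomogM _ _ ha) pihomog_kd // subn1 /=.
  move=> h1; rewrite kd_lin.
  set X := pihomog _ _ (c s) in h1 *; set Y := pihomog _ _ _ in h1.
  have -> : X - (a * kd z b s + kd z (fun t => pihomog mdeg e (f t)) s) =
    (X - (Y * a + kd z (fun t => pihomog mdeg e (f t)) s)) + a * (Y - kd z b s).
    by ring.
  by apply: idealD => //; apply: ideal_mull => //; apply: bP.
(* D bounds the sizes of all relevant values of [c], so each is the sum of its components below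
   D. *)
pose D := (\max_(t : (size z).-tuple bool) msize (c t))%N.
have [b bN bP] := kcobound_sum D idB idN comp.
exists b => // s ss si.
have <- : \sum_(e < D) pihomog mdeg e (c s) = c s; last exact: bP.
apply/esym/pihomog_partitionE.
have szs : size s == size z by apply/eqP.
exact: (leq_bigmax (Tuple szs)).
Qed.

End Polynomials.

Lemma noetherian_mpoly (K : fieldType) n : noetherian {mpoly K[n]}.
Proof.
elim: n => [|n IH].
  apply: (@noetherian_surj K {mpoly K[0]} (@mpolyC 0 K)); last exact: noetherian_field.
  by move=> p; exists p@_0%MM; apply: mpolyKC.
apply: (@noetherian_surj {poly {mpoly K[n]}} {mpoly K[n.+1]}
  (horner_eval ('X_ord_max) \o map_poly (@mwiden n K))); last exact: hilbert_basis.
elim/mpoly_ring_ind => [c|i|p q [a <-] [b <-]|p q [a <-] [b <-]].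
- by exists (c%:MP)%:P; rewrite /= map_polyC /= /horner_eval hornerC mwidenC.
- case: (unliftP ord_max i) => [j ->|->].
    exists ('X_j)%:P; rewrite /= map_polyC /= /horner_eval hornerC /mwiden mmapX.
    rewrite mmap1U; congr 'X__; apply: val_inj; by rewrite /= /bump leqNgt ltn_ord.
  by exists 'X; rewrite /= map_polyX /horner_eval hornerX.
- by exists (a + b); rewrite rmorphD.
- by exists (a * b); rewrite rmorphM.
Qed.

Section Evaluation.
Variables (K : fieldType) (V : finType).
Local Notation S := {mpoly K[#|{: V + V}|]}.

Lemma mpoly_xy_ind (P : S -> Prop) :
  (forall c, P c%:MP) -> (forall u, P (xvar K u)) -> (forall u, P (yvar K u)) ->
  (forall p q, P p -> P q -> P (p + q)) -> (forall p q, P p -> P q -> P (p * q)) ->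
  forall p, P p.
Proof.
move=> PC Px Py PD PM; apply: mpoly_ring_ind => // i.
by rewrite -(enum_valK i); case: (enum_val i) => u; [apply: Px | apply: Py].
Qed.

Variable A : comNzRingType.

Variables (f : {rmorphism K -> A}) (a b : V -> A).

Definition ev : S -> A := mmap f
  (fun k => match enum_val k with inl u => a u | inr u => b u end).

HB.instance Definition _ := GRing.RMorphism.on ev.

Lemma ev_x u : ev (xvar K u) = a u.
Proof. by rewrite /ev mmapX mmap1U enum_rankK. Qed.

Lemma ev_y u : ev (yvar K u) = b u.
Proof. by rewrite /ev mmapX mmap1U enum_rankK. Qed.

Lemma evC c : ev c%:MP = f c.
Proof. exact: mmapC. Qed.

End Evaluation.

(** * Binomial and determinantal ideals *)

Section BinomialIdeals.
Variables (K : fieldType) (V : finType).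
Local Notation S := {mpoly K[#|{: V + V}|]}.
Local Notation x := (@xvar K V).
Local Notation y := (@yvar K V).

Definition minor (u w : V) : S := x u * y w - x w * y u.

(** One family covers edge ideals, the ideal of all minors, (x_v, y_v) + J_H and the ideals
    generated by variables, so that homogeneity and similar facts are proved once. *)
Definition bgens (Zx Zy : pred V) (E : rel V) : {pred S} := [pred f : S |
  [|| [exists u, Zx u && (f == x u)], [exists u, Zy u && (f == y u)] |
      [exists u, exists w, E u w && (f == minor u w)]]].

Definition bideal (Zx Zy : pred V) (E : rel V) : {pred S} := ideal_gen (bgens Zx Zy E).

Implicit Types (Zx Zy : pred V) (E : rel V) (I : {pred S}) (f g : S).

Lemma bideal_ideal Zx Zy E : is_ideal (bideal Zx Zy E).
Proof. exact: ideal_gen_ideal. Qed.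

Lemma bideal_x Zx Zy E u : Zx u -> x u \in bideal Zx Zy E.
Proof.
move=> Zu; apply: mem_ideal_gen; rewrite inE; apply/or3P/Or31/existsP.
by exists u; rewrite Zu eqxx.
Qed.

Lemma bideal_y Zx Zy E u : Zy u -> y u \in bideal Zx Zy E.
Proof.
move=> Zu; apply: mem_ideal_gen; rewrite inE; apply/or3P/Or32/existsP.
by exists u; rewrite Zu eqxx.
Qed.

Lemma bideal_minor Zx Zy E u w : E u w -> minor u w \in bideal Zx Zy E.
Proof.
move=> Zu; apply: mem_ideal_gen; rewrite inE; apply/or3P/Or33/existsP.
by exists u; apply/existsP; exists w; rewrite Zu eqxx.
Qed.

Lemma bideal_sub Zx Zy E I : is_ideal I -> (forall u, Zx u -> x u \in I) ->
  (forall u, Zy u -> y u \in I) -> (forall u w, E u w -> minor u w \in I) ->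
  {subset bideal Zx Zy E <= I}.
Proof.
move=> idI Ix Iy IE; apply: ideal_gen_sub => // f; rewrite inE => /or3P[].
- by case/existsP=> u /andP[/Ix h /eqP->].
- by case/existsP=> u /andP[/Iy h /eqP->].
- by case/existsP=> u /existsP[w /andP[/IE h /eqP->]].
Qed.

Lemma xvar_homog u : x u \is 1.-homog.
Proof. by rewrite dhomogX /= mdeg1. Qed.

Lemma yvar_homog u : y u \is 1.-homog.
Proof. by rewrite dhomogX /= mdeg1. Qed.

Lemma bideal_homogeneous Zx Zy E : homogeneous_ideal (bideal Zx Zy E).
Proof.
apply: homogeneous_ideal_gen => f; rewrite inE => /or3P[].
- by case/existsP=> u /andP[_ /eqP->]; exists 1%N; apply: xvar_homog.
- by case/existsP=> u /andP[_ /eqP->]; exists 1%N; apply: yvar_homog.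
- case/existsP=> u /existsP[w /andP[_ /eqP->]]; exists 2%N; rewrite /minor.
  by apply: rpredB; apply: (@dhomogM _ _ _ 1 _ 1); rewrite ?xvar_homog ?yvar_homog.
Qed.

Lemma bideal_edge (G : sgraph V) :
  @binomial_edge_ideal K V G =i bideal pred0 pred0 (edge G).
Proof.
move=> f; apply/idP/idP.
  apply: ideal_gen_sub; first exact: bideal_ideal.
  move=> g /existsP[u /existsP[w /andP[e /eqP->]]].
  exact: bideal_minor.
apply: bideal_sub; [exact: ideal_gen_ideal | by [] | by [] |].
move=> u w e; apply: mem_ideal_gen; rewrite inE; apply/existsP; exists u.
by apply/existsP; exists w; rewrite e eqxx.
Qed.

Lemma minorC u w : minor u w = - minor w u.
Proof. by rewrite /minor; ring. Qed.

Lemma minor_id u : minor u u = 0.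
Proof. by rewrite /minor subrr. Qed.

Lemma minor_out Zx Zy E u w : Zx u -> Zy u -> minor u w \in bideal Zx Zy E.
Proof.
move=> hx hy; have idI := bideal_ideal Zx Zy E.
apply: (idealB idI); first by apply: (ideal_mulr idI); apply: bideal_x.
by apply: (ideal_mull idI); apply: bideal_y.
Qed.

Definition kill (Zx Zy : pred V) : S -> S :=
  ev (@mpolyC _ K) (fun u => if Zx u then 0 else x u) (fun u => if Zy u then 0 else y u).

HB.instance Definition _ Zx Zy := GRing.RMorphism.on (kill Zx Zy).

Lemma kill_x Zx Zy u : kill Zx Zy (x u) = if Zx u then 0 else x u.
Proof. exact: ev_x. Qed.

Lemma kill_y Zx Zy u : kill Zx Zy (y u) = if Zy u then 0 else y u.
Proof. exact: ev_y. Qed.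

Lemma kill_mod Zx Zy I f : is_ideal I -> (forall u, Zx u -> x u \in I) ->
  (forall u, Zy u -> y u \in I) -> f - kill Zx Zy f \in I.
Proof.
move=> idI Ix Iy; elim/mpoly_xy_ind: f => [c|u|u|p q hp hq|p q hp hq].
- by rewrite /kill evC subrr ideal0.
- by rewrite kill_x; case: ifP => [/Ix|_]; rewrite ?subr0 // subrr ideal0.
- by rewrite kill_y; case: ifP => [/Iy|_]; rewrite ?subr0 // subrr ideal0.
- by rewrite rmorphD /= opprD addrACA; exact: (idealD idI hp hq).
- rewrite rmorphM /=.
  have -> : p * q - kill Zx Zy p * kill Zx Zy q =
    p * (q - kill Zx Zy q) + (p - kill Zx Zy p) * kill Zx Zy q.
    by rewrite mulrBr mulrBl addrA subrK.
  exact: (idealD idI (ideal_mull idI _ hq) (ideal_mulr idI _ hp)).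
Qed.

Definition linear_ideal Zx Zy := bideal Zx Zy (fun _ _ => false).

Lemma linear_ideal_sub Zx Zy I : is_ideal I -> (forall u, Zx u -> x u \in I) ->
  (forall u, Zy u -> y u \in I) -> {subset linear_ideal Zx Zy <= I}.
Proof. by move=> idI Ix Iy; apply: (bideal_sub idI Ix Iy) => u w; discriminate. Qed.

(** [f] and [kill Zx Zy f] are congruent modulo the killed variables. As the kernel of a map to a
    domain the ideal is prime. *)
Lemma linear_idealE Zx Zy f : (f \in linear_ideal Zx Zy) = (kill Zx Zy f == 0).
Proof.
apply/idP/eqP => [|k0].
  suff : {subset linear_ideal Zx Zy <= [pred f | kill Zx Zy f == 0]}.
    by move=> h /h /eqP.
  apply: linear_ideal_sub; first exact: ker_ideal.
  - by move=> u h; rewrite inE kill_x h.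
  - by move=> u h; rewrite inE kill_y h.
rewrite -[f]subr0 -k0; apply: kill_mod; first exact: bideal_ideal.
  by move=> u; apply: bideal_x.
by move=> u; apply: bideal_y.
Qed.

Lemma linear_ideal_prime Zx Zy f g :
  f * g \in linear_ideal Zx Zy -> f \notin linear_ideal Zx Zy -> g \in linear_ideal Zx Zy.
Proof.
rewrite !linear_idealE; exact: (@ker_prime S S (kill Zx Zy)).
Qed.

(* Parametrizes the 2 x V matrices of rank at most one. *)
Local Notation T := {mpoly K[#|{: V + unit}|]}.
Definition seg_a (u : V) : T := 'X_(enum_rank (inl u : V + unit)%type).
Definition seg_t : T := 'X_(enum_rank (inr tt : V + unit)%type).
Definition segre : S -> T := ev (@mpolyC _ K) seg_a (fun u => seg_a u * seg_t).

HB.instance Definition _ := GRing.RMorphism.on segre.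

Definition det_ideal : {pred S} := bideal pred0 pred0 (fun _ _ => true).

Let mono (a b : V -> nat) : S := \prod_u (x u ^+ a u * y u ^+ b u).

Let monoD a b a' b' : mono (fun u => a u + a' u)%N (fun u => b u + b' u)%N
  = mono a b * mono a' b'.
Proof. by rewrite -big_split /=; apply: eq_bigr => u _; rewrite !exprD mulrACA. Qed.

Let mono_x j : mono (fun u => u == j) (fun=> 0%N) = x j.
Proof.
rewrite /mono (bigD1 j) //= eqxx !expr1 expr0 mulr1 big1 ?mulr1 // => u /negbTE->.
by rewrite !expr0 mulr1.
Qed.

Let mono_y j : mono (fun=> 0%N) (fun u => u == j) = y j.
Proof.
rewrite /mono (bigD1 j) //= eqxx !expr1 expr0 mul1r big1 ?mulr1 // => u /negbTE->.
by rewrite !expr0 mulr1.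
Qed.

Let mono_swap a b i j : (0 < a j)%N -> (0 < b i)%N ->
  mono a b - mono (fun u => a u - (u == j) + (u == i))%N
                  (fun u => b u - (u == i) + (u == j))%N \in det_ideal.
Proof.
move=> aj bi; have idI := bideal_ideal pred0 pred0 (fun _ _ => true).
set a1 := (fun u => a u - (u == j))%N; set b1 := (fun u => b u - (u == i))%N.
have e1 : mono a b = mono a1 b1 * (x j * y i).
  rewrite -mono_x -mono_y -!monoD; congr mono; apply/funext => u; rewrite /a1 /b1.
    by case: (eqVneq u j) => [->|_] /=; lia.
  by case: (eqVneq u i) => [->|_] /=; lia.
have -> : mono (fun u => a u - (u == j) + (u == i))%N
               (fun u => b u - (u == i) + (u == j))%N = mono a1 b1 * (x i * y j).
  rewrite -mono_x -mono_y -!monoD; congr mono; apply/funext => u; rewrite /a1 /b1.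
    by lia.
rewrite e1 -mulrBr; apply: (ideal_mull idI).
by rewrite -[_ - _]/(minor j i); apply: bideal_minor.
Qed.

(** Induction on the total excess of b over b'. Where some b i is too large, some b j is too small
    because the sums agree, and a swap, which costs a multiple of a minor, lowers the excess by
    one. *)
Let mono_eqmod a b a' b' : (forall u, a u + b u = a' u + b' u)%N ->
  (\sum_u b u = \sum_u b' u)%N -> mono a b - mono a' b' \in det_ideal.
Proof.
have idI := bideal_ideal pred0 pred0 (fun _ _ => true).
move: {2}(\sum_u (b u - b' u))%N (erefl (\sum_u (b u - b' u))%N) => n.
elim: n a b => [|n IH] a b en eab eb.
  have le u : (b u <= b' u)%N.
    by rewrite -subn_eq0 -leqn0 -en (bigD1 u) //= leq_addr.
  have e u : b u = b' u.
    apply/eqP; rewrite eqn_leq le /= leqNgt; apply/negP => lt.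
    move: (eb); rewrite (bigD1 u) //= [RHS](bigD1 u) //= => e2.
    have : (\sum_(i | i != u) b i <= \sum_(i | i != u) b' i)%N by apply: leq_sum.
    lia.
  have -> : a = a' by apply/funext => u; have := eab u; rewrite e; lia.
  have -> : b = b' by apply/funext.
  by rewrite subrr ideal0.
have [i lti] : exists i, (b' i < b i)%N.
  apply: contrapT => ni; suff : (\sum_u (b u - b' u) = 0)%N by rewrite en.
  apply: big1 => u _; apply/eqP; rewrite subn_eq0 leqNgt; apply/negP => lt.
  by apply: ni; exists u.
have [j ltj] : exists j, (b j < b' j)%N.
  apply: contrapT => nj.
  have le u : (b' u <= b u)%N.
    by rewrite leqNgt; apply/negP => lt; apply: nj; exists u.
  move: (eb); rewrite (bigD1 i) //= [RHS](bigD1 i) //=.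
  have : (\sum_(u | u != i) b' u <= \sum_(u | u != i) b u)%N by apply: leq_sum.
  lia.
have ij : i != j by apply/eqP => e; subst; lia.
have aj : (0 < a j)%N by have := eab j; lia.
have bi : (0 < b i)%N by lia.
rewrite -(subrK (mono (fun u => a u - (u == j) + (u == i))%N
                      (fun u => b u - (u == i) + (u == j))%N) (mono a b)) -addrA.
apply: (idealD idI); first exact: mono_swap.
apply: IH.
- apply/eqP; rewrite -(eqn_add2r 1) !addn1 -en; apply/eqP.
  rewrite (bigD1 i) //= [RHS](bigD1 i) //= eqxx (negbTE ij).
  have -> : (\sum_(u | u != i) (b u - (u == i) + (u == j) - b' u) =
             \sum_(u | u != i) (b u - b' u))%N.
    apply: eq_bigr => u /negbTE->; case: (eqVneq u j) => [->|_]; lia.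
  lia.
- move=> u; have := eab u; case: (eqVneq u i) => [->|ui].
    by rewrite (negbTE ij) /=; lia.
  by case: (eqVneq u j) => [->|uj] /=; lia.
rewrite -eb (bigD1 i) //= [RHS](bigD1 i) //= eqxx (negbTE ij).
rewrite (bigD1 j) 1?eq_sym //= [in RHS](bigD1 j) 1?eq_sym //= eqxx.
rewrite (eq_sym j i) (negbTE ij).
have -> : (\sum_(u | (u != i) && (u != j)) (b u - (u == i) + (u == j)) =
           \sum_(u | (u != i) && (u != j)) b u)%N.
  by apply: eq_bigr => u /andP[/negbTE-> /negbTE->]; lia.
lia.
Qed.

Let exa (m : 'X_{1..#|{: V + V}|}) (u : V) := m (enum_rank (inl u : V + V)%type).
Let exb (m : 'X_{1..#|{: V + V}|}) (u : V) := m (enum_rank (inr u : V + V)%type).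

Let monoE m : 'X_[m] = mono (exa m) (exb m).
Proof.
rewrite mpolyXE_id (reindex (@enum_rank {: V + V})) /=; last first.
  by exists enum_val => i _; rewrite ?enum_rankK ?enum_valK.
by rewrite big_sumType /= /mono big_split.
Qed.

Let exp_seg (m : 'X_{1..#|{: V + V}|}) : 'X_{1..#|{: V + unit}|} :=
  [multinom (match enum_val k with inl u => exa m u + exb m u
             | inr _ => \sum_u exb m u end)%N | k < #|{: V + unit}|].

Let segreX m : segre 'X_[m] = 'X_[exp_seg m].
Proof.
rewrite monoE mpolyXE_id (reindex (@enum_rank {: V + unit})) /=; last first.
  by exists enum_val => i _; rewrite ?enum_rankK ?enum_valK.
rewrite big_sumType /= (big_pred1 tt) //.
rewrite rmorph_prod mnmE enum_rankK -prodrXr -big_split /=; apply: eq_bigr => u _.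
by rewrite rmorphM !rmorphXn /= /segre ev_x ev_y exprMn mulrA -exprD mnmE enum_rankK.
Qed.

Let exp_seg_eqmod m m' : exp_seg m = exp_seg m' -> 'X_[m] - 'X_[m'] \in det_ideal.
Proof.
move=> e; rewrite !monoE; apply: mono_eqmod => [u|].
  have := congr1 (fun h : 'X_{1..#|{: V + unit}|} => h (enum_rank (inl u))) e.
  by rewrite !mnmE !enum_rankK.
have := congr1 (fun h : 'X_{1..#|{: V + unit}|} => h (enum_rank (inr tt))) e.
by rewrite !mnmE !enum_rankK.
Qed.

Lemma segre_minor u w : segre (minor u w) = 0.
Proof. by rewrite rmorphB !rmorphM /= /segre !ev_x !ev_y; ring. Qed.

(* Monomials with the same image under [segre] are congruent modulo the minors,
   so [f] is congruent to an expression in the coefficients of [segre f]. *)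
Lemma det_idealE f : (f \in det_ideal) = (segre f == 0).
Proof.
have idI := bideal_ideal pred0 pred0 (fun _ _ => true).
apply/idP/eqP => [|f0].
  suff : {subset det_ideal <= [pred f | segre f == 0]} by move=> h /h /eqP.
  apply: bideal_sub; [exact: ker_ideal | by [] | by [] |].
  by move=> u w _; rewrite inE segre_minor.
(* [r k] represents all monomials whose image has exponent k; it is 0 if there are none. *)
have : forall k, exists r, forall m, exp_seg m = k -> 'X_[m] - r \in det_ideal.
  move=> k; case: (pselect (exists m, exp_seg m = k)) => [[m em]|n].
    by exists 'X_[m] => m' em'; apply: exp_seg_eqmod; rewrite em em'.
  by exists 0 => m em; case: n; exists m.
move=> /choice[r rP].
pose ks := undup [seq exp_seg m | m <- msupp f].
(* Collected by image exponent, the coefficient of [r k] is that of [segre f] at k. *)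
have e2 : \sum_(m <- msupp f) f@_m *: r (exp_seg m) = 0.
  transitivity (\sum_(m <- msupp f) \sum_(k <- ks | k == exp_seg m) f@_m *: r k).
    apply: eq_big_seq => m mf; rewrite (big_rem (exp_seg m)) /=; last first.
      by rewrite mem_undup map_f.
    rewrite eqxx big1_seq ?addr0 // => k /andP[/eqP->].
    by rewrite rem_filter ?undup_uniq // mem_filter /= eqxx.
  rewrite (exchange_big_dep predT) //= big1 // => k _.
  rewrite -scaler_suml.
  have <- : (segre f)@_k = \sum_(m <- msupp f | k == exp_seg m) f@_m.
    rewrite {1}(mpolyE f) rmorph_sum raddf_sum /= [RHS]big_mkcond /=.
    apply: eq_bigr => m _; rewrite -mul_mpolyC rmorphM /= segreX /segre evC.
    rewrite mcoeffCM mcoeffX eq_sym; by case: eqP; rewrite ?mulr1 ?mulr0.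
  by rewrite f0 mcoeff0 scale0r.
rewrite -[f]subr0 -e2 {1}(mpolyE f) -sumrB; apply: (ideal_sum idI) => m _.
rewrite -scalerBr -mul_mpolyC; apply: (ideal_mull idI); exact: rP.
Qed.

(** The variables of the columns outside W are adjoined to the minors, so that the induction on W
    stays in one ring. *)
Definition det_ideal_on (W : {set V}) : {pred S} :=
  bideal [pred u | u \notin W] [pred u | u \notin W] (fun _ _ => true).

Lemma det_ideal_onE W f :
  (f \in det_ideal_on W) =
    (segre (kill [pred u | u \notin W] [pred u | u \notin W] f) == 0).
Proof.
set Z := [pred u | u \notin W].
apply/idP/idP => [|].
  suff : {subset det_ideal_on W <= [pred f | segre (kill Z Z f) == 0]} by apply.
  apply: bideal_sub; first exact: (ker_ideal (segre \o kill Z Z)).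
  - by move=> u h; rewrite inE kill_x h rmorph0.
  - by move=> u h; rewrite inE kill_y h rmorph0.
  - move=> u w _; rewrite inE /minor rmorphB !rmorphM /= !kill_x !kill_y.
    have := segre_minor u w; rewrite /minor => e.
    by case: ifP => _; case: ifP => _; rewrite ?e ?mul0r ?mulr0 ?subr0 ?sub0r ?oppr0 ?rmorph0.
rewrite -det_idealE => h.
have idI := bideal_ideal Z Z (fun _ _ => true).
rewrite -(subrK (kill Z Z f) f); apply: (idealD idI).
  by apply: (kill_mod _ idI) => u; [apply: bideal_x | apply: bideal_y].
apply: (bideal_sub idI _ _ _ h); [by [] | by [] |].
by move=> u w _; apply: bideal_minor.
Qed.

Lemma det_ideal_on_prime W f g :
  f * g \in det_ideal_on W -> f \notin det_ideal_on W -> g \in det_ideal_on W.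
Proof.
rewrite !det_ideal_onE; exact: (@ker_prime S T (segre \o kill _ _)).
Qed.

Lemma det_ideal_onT : det_ideal =i det_ideal_on [set: V].
Proof.
move=> f; apply/idP/idP.
  by apply: bideal_sub; [apply: bideal_ideal | | | move=> u w _; apply: bideal_minor].
apply: bideal_sub; first exact: bideal_ideal.
- by move=> u; rewrite /= inE.
- by move=> u; rewrite /= inE.
- by move=> u w _; apply: bideal_minor.
Qed.

Lemma xvar_det_ideal_on W u : (x u \in det_ideal_on W) = (u \notin W).
Proof.
rewrite det_ideal_onE kill_x inE; case: (u \in W) => /=; last by rewrite rmorph0 eqxx.
rewrite /segre ev_x /seg_a; apply/negP => /eqP /mpolyP /(_ U_(enum_rank (inl u))%MM).
by rewrite mcoeffXU eqxx mcoeff0 => /eqP; rewrite oner_eq0.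
Qed.

Lemma yvar_linear_ideal Zx Zy u : (y u \in linear_ideal Zx Zy) = Zy u.
Proof.
rewrite linear_idealE kill_y; case: (Zy u); rewrite ?eqxx //.
apply/negP => /eqP /mpolyP /(_ U_(enum_rank (inr u))%MM).
by rewrite mcoeffXU eqxx mcoeff0 => /eqP; rewrite oner_eq0.
Qed.

End BinomialIdeals.

(** * Depth of the determinantal ideals *)

Lemma eq_mem_pred (T : Type) (I J : {pred T}) : I =i J -> I = J.
Proof. by move=> IJ; apply/funext => u; have := IJ u; rewrite !unfold_in. Qed.

Section DeterminantalDepth.
Variables (K : fieldType) (V : finType).
Local Notation S := {mpoly K[#|{: V + V}|]}.
Local Notation x := (@xvar K V).
Local Notation y := (@yvar K V).
Variable z : seq S.
Hypothesis zx : forall u, x u \in ideal_span z.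
Hypothesis zy : forall u, y u \in ideal_span z.
Implicit Types (W : {set V}).

(** The quotient is the polynomial ring in the y_u with u in W. *)
Definition xideal_on W : {pred S} := @linear_ideal K V predT [pred u | u \notin W].

Lemma xideal_onD1 W i : i \in W ->
  ideal_gen [predU xideal_on W & [:: y i]] = xideal_on (W :\ i).
Proof.
move=> iW; have idL := @bideal_ideal K V predT [pred u | u \notin W :\ i] (fun _ _ => false).
have idR := ideal_gen_ideal [predU xideal_on W & [:: y i]].
apply/eq_mem_pred => f; apply/idP/idP.
  apply: (ideal_gen_sub idL) => g; rewrite !inE => /orP[|/eqP->].
    apply: (linear_ideal_sub idL); first by move=> u _; apply: bideal_x.
    by move=> u uW; apply: bideal_y; rewrite !inE negb_and (negbTE uW) orbT.
  by apply: bideal_y; rewrite !inE eqxx.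
have sub g : g \in xideal_on W -> g \in ideal_gen [predU xideal_on W & [:: y i]].
  by move=> gW; apply: mem_ideal_gen; rewrite inE gW.
apply: (linear_ideal_sub idR); first by move=> u _; apply/sub/bideal_x.
move=> u /=; rewrite !inE negb_and negbK => /orP[/eqP->|uW].
  by apply: mem_ideal_gen; rewrite !inE eqxx orbT.
exact/sub/bideal_y.
Qed.

Lemma kdepth_xideal W : kdepth z (xideal_on W) predT #|W|.
Proof.
move: {2}#|W| (erefl #|W|) => n; elim: n W => [|n IH] W cW.
  by rewrite cW; apply: kdepth0.
have [i iW] : exists i, i \in W by apply/card_gt0P; rewrite cW.
have cW' : #|W :\ i| = n by have := cardsD1 i W; rewrite iW cW => -[].
rewrite cW; apply: (kdepth_regular (f := y i)).
- exact: bideal_ideal.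
- move=> g h; apply: (linear_ideal_prime h).
  by rewrite yvar_linear_ideal inE iW.
- exact: zy.
- by rewrite xideal_onD1 // -cW'; apply: IH.
Qed.

(** Let I be the left side. An element of the intersection lies in I + (y_i), so it is y_i q modulo
    I. Then q is in the prime [xideal_on W], which y_i multiplies into I because y_i x_u is a minor
    plus x_i y_u. *)
Lemma det_xideal_I W i : i \in W ->
  ideal_gen [predU @det_ideal_on K V W & [:: x i]] =
  [predI xideal_on W & @det_ideal_on K V (W :\ i)].
Proof.
move=> iW; set Z := [pred u | u \notin W]; set Z' := [pred u | u \notin W :\ i].
have idX : is_ideal (xideal_on W) by apply: bideal_ideal.
have idD : is_ideal (@det_ideal_on K V (W :\ i)) by apply: bideal_ideal.
have idI := ideal_gen_ideal [predU @det_ideal_on K V W & [:: x i]].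
have subI g : g \in @det_ideal_on K V W -> g \in ideal_gen [predU @det_ideal_on K V W & [:: x i]].
  by move=> gW; apply: mem_ideal_gen; rewrite inE gW.
have xiI : x i \in ideal_gen [predU @det_ideal_on K V W & [:: x i]].
  by apply: mem_ideal_gen; rewrite !inE eqxx orbT.
have ZZ' u : Z u -> Z' u by rewrite /Z /Z' !inE => /negbTE->; rewrite andbF.
have Z'i : Z' i by rewrite /Z' !inE eqxx.
apply/eq_mem_pred => f; apply/idP/idP.
  apply: (ideal_gen_sub (ideal_setI idX idD)) => g.
  rewrite !inE => /orP[gW|/eqP->]; apply/andP; split.
  - apply: (bideal_sub idX _ _ _ gW) => [u _|u uW|u w _].
    + exact: bideal_x.
    + exact: bideal_y.
    + have xX v : x v \in xideal_on W by apply: bideal_x.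
      exact: (idealB idX (ideal_mulr idX _ (xX _)) (ideal_mulr idX _ (xX _))).
  - apply: (bideal_sub idD _ _ _ gW) => [u /ZZ' uW|u /ZZ' uW|u w _].
    + exact: bideal_x.
    + exact: bideal_y.
    + exact: bideal_minor.
  - exact: bideal_x.
  - exact: bideal_x.
rewrite inE => /andP[fX fD].
(* Modulo [I], [f] is a multiple of [y_i]. *)
pose Y := ideal_gen [predU ideal_gen [predU @det_ideal_on K V W & [:: x i]] & [:: y i]].
have idY : is_ideal Y by apply: ideal_gen_ideal.
have subY g : g \in ideal_gen [predU @det_ideal_on K V W & [:: x i]] -> g \in Y.
  by move=> gW; apply: mem_ideal_gen; rewrite inE gW.
have yiY : y i \in Y by apply: mem_ideal_gen; rewrite !inE eqxx orbT.
have fY : f \in Y.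
  apply: (bideal_sub idY _ _ _ fD) => [u|u|u w _]; last exact/subY/subI/bideal_minor.
    rewrite /= !inE negb_and negbK => /orP[/eqP->|uW]; first exact: (subY _ xiI).
    exact/subY/subI/bideal_x.
  rewrite /= !inE negb_and negbK => /orP[/eqP->|uW]; first exact: yiY.
  exact/subY/subI/bideal_y.
have [q fq] := ideal_add1P idI fY.
have IX : {subset ideal_gen [predU @det_ideal_on K V W & [:: x i]] <= xideal_on W}.
  apply: (ideal_gen_sub idX) => g; rewrite !inE => /orP[gW|/eqP->]; last exact: bideal_x.
  apply: (bideal_sub idX _ _ _ gW) => [u _|u uW|u w _].
  - exact: bideal_x.
  - exact: bideal_y.
  - have xX v : x v \in xideal_on W by apply: bideal_x.
    exact: (idealB idX (ideal_mulr idX _ (xX _)) (ideal_mulr idX _ (xX _))).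
have yqX : y i * q \in xideal_on W by apply: (ideal_eqmod' idX (IX _ fq) fX).
have qX : q \in xideal_on W.
  apply: (linear_ideal_prime yqX); by rewrite yvar_linear_ideal /= iW.
apply: (ideal_eqmod idI fq).
suff : {subset xideal_on W <= [pred q | y i * q \in
   ideal_gen [predU @det_ideal_on K V W & [:: x i]]]} by move=> /(_ _ qX).
apply: linear_ideal_sub.
- split; first by rewrite inE mulr0; apply: (ideal0 idI).
  move=> a g h; rewrite !inE mulrDr mulrCA; exact: idI.2.
- move=> u _; rewrite inE.
  have -> : y i * x u = @minor K V u i + x i * y u.
    by rewrite /minor (mulrC (y i)) subrK.
  apply: (idealD idI); last exact: (ideal_mulr idI _ xiI).
  exact/subI/bideal_minor.
- move=> u uW; rewrite inE; apply: (ideal_mull idI); exact/subI/bideal_y.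
Qed.

Lemma xideal_det_add W i : i \in W ->
  ideal_add (xideal_on W) (@det_ideal_on K V (W :\ i)) = xideal_on (W :\ i).
Proof.
move=> iW.
have idX : is_ideal (xideal_on (W :\ i)) by apply: bideal_ideal.
have idA := ideal_add_ideal (xideal_on W) (@det_ideal_on K V (W :\ i)).
apply/eq_mem_pred => f; apply/idP/idP.
  apply: (ideal_gen_sub idX) => g; rewrite inE => /orP[gW|gD].
    apply: (linear_ideal_sub idX _ _ gW) => [u _|u uW]; first exact: bideal_x.
    by apply: bideal_y; rewrite /= !inE (negbTE uW) andbF.
  apply: (bideal_sub idX _ _ _ gD) => [u _|u uW|u w _].
  - exact: bideal_x.
  - exact: bideal_y.
  - have xX v : x v \in xideal_on (W :\ i) by apply: bideal_x.
    exact: (idealB idX (ideal_mulr idX _ (xX _)) (ideal_mulr idX _ (xX _))).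
apply: (linear_ideal_sub idA) => [u _|u uW].
  exact/ideal_addl/bideal_x.
exact/ideal_addr/bideal_y.
Qed.

(* In the inductive step, modulo a regular variable x_i the determinantal ideal
   is the intersection of [xideal_on W] and of the determinantal ideal on
   [W :\ i]. *)
Lemma kdepth_det_ideal_on W : W != set0 -> kdepth z (@det_ideal_on K V W) predT #|W|.+1.
Proof.
move: {2}#|W| (erefl #|W|) => n; elim: n W => [|n IH] W cW W0.
  by move: W0; rewrite -cards_eq0 cW.
have [i iW] : exists i, i \in W by apply/card_gt0P; rewrite cW.
have cW' : #|W :\ i| = n by have := cardsD1 i W; rewrite iW cW => -[].
have idX : is_ideal (xideal_on W) by apply: bideal_ideal.
have idD : is_ideal (@det_ideal_on K V (W :\ i)) by apply: bideal_ideal.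
apply: (kdepth_regular (f := x i)).
- exact: bideal_ideal.
- move=> g h; apply: (det_ideal_on_prime h).
  by rewrite xvar_det_ideal_on negbK iW.
- exact: zx.
rewrite det_xideal_I //.
apply: (kdepth_ext (J := xideal_on W)).
- exact: ideal_setI.
- exact: idX.
- exact: ideal_setT.
- by move=> f; rewrite inE => /andP[].
- by [].
(* If W minus i is empty, the second ideal contains all variables, hence the first ideal, and the
   module in question is zero. *)
- have [W'0|W'0] := eqVneq (W :\ i) set0.
    move=> k c _ [cX cd]; exists (fun=> 0) => [s|s ss si]; first exact: (ideal0 idX).
    rewrite kd0 subr0 inE cX /=.
    apply: (linear_ideal_sub idD _ _ (cX s)) => [u _|u _].
      by apply: bideal_x; rewrite /= W'0 inE.
    by apply: bideal_y; rewrite /= W'0 inE.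
  (* With X = [xideal_on W] and D the determinantal ideal on W minus i, the module becomes (X + D) /
     D, a submodule of S / D whose cokernel is again a polynomial ring. *)
  apply: kdepth_iso => //; rewrite xideal_det_add // cW.
  apply: (kdepth_sub idD _ (@ideal_setT S)).
  + exact: bideal_ideal.
  + move=> f; rewrite -(xideal_det_add iW); exact: ideal_addr.
  + by [].
  + by rewrite -cW'; apply: IH.
  + by rewrite -cW'; apply: kdepth_xideal.
- exact: kdepth_xideal.
Qed.

End DeterminantalDepth.

(** * The cone *)

Section Separator.
Variables (T : finType) (H : sgraph T).
Implicit Types (X U A : {set T}) (c u w p q i j : T).

Definition edge_in (U : {set T}) : rel T :=
  [rel p q | [&& edge H p q, p \in U & q \in U]].

Let separates X := [exists u, exists w,
  [&& u \notin X, w \notin X & ~~ connect (edge_in (~: X)) u w]].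

Let separatesPn X u w : ~~ separates X -> u \notin X -> w \notin X ->
  connect (edge_in (~: X)) u w.
Proof.
move=> /existsPn/(_ u)/existsPn/(_ w); rewrite !negb_and !negbK.
by move=> h uX wX; case/or3P: h => //; rewrite ?(negbTE uX) ?(negbTE wX).
Qed.

(* Obtained from a minimal separating set [X] by taking c in X and U = ~: X;
   A is a connected component of the graph induced on U. *)
Lemma minimal_separator : connected_graph H -> ~ complete_graph H ->
  exists c u w U A, [/\ [/\ c \notin U, u \in A, A \subset U, w \in U & w \notin A],
    forall p q, p \in U -> q \in U -> edge H p q -> (p \in A) = (q \in A),
    forall p q, p \in c |: U -> q \in c |: U -> connect (edge_in (c |: U)) p q &
    forall i, exists2 p, p \in c |: U & i = p \/ edge H i p].
Proof.
move=> Hconn Hnc.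
have [a [b [ab nab]]] : exists a b, a != b /\ ~~ edge H a b.
  apply: contrapT => n; apply: Hnc => a b ab; apply/negPn/negP => nab.
  by apply: n; exists a, b.
(* The complement of two non-adjacent vertices separates them. *)
have sepab : separates (~: [set a; b]).
  apply/existsP; exists a; apply/existsP; exists b; rewrite setCK !inE !eqxx orbT /=.
  apply/negP => /connectP[[|p1 l] /= hl eb]; first by rewrite eb eqxx in ab.
  case/andP: hl => /and3P[e1 _]; rewrite !inE => /orP[/eqP ep|/eqP ep] _.
    by rewrite ep edge_irr in e1.
  by rewrite -ep e1 in nab.
have [X /minsetP[sepX minX] _] := minset_exists sepab.
(* Connectedness of H makes a minimal separating set nonempty. *)
have sep0 : ~~ separates set0.
  apply/existsPn => u; apply/existsPn => w; rewrite !inE /= negbK.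
  rewrite (eq_connect (e' := edge H)); first exact: Hconn.
  by move=> p q; rewrite /edge_in /= !inE !andbT.
have Xn0 : X != set0 by apply: contraNneq sep0 => <-.
have [c cX] : exists c, c \in X by apply/set0Pn.
have nsep i : i \in X -> ~~ separates (X :\ i).
  move=> iX; apply/negP => h; have := minX _ h (subD1set _ _) => e.
  by move: iX; rewrite -e !inE eqxx.
have cU i : i \in X -> ~: (X :\ i) = i |: ~: X.
  by move=> iX; apply/setP => p; rewrite !inE negb_and negbK.
have /existsP[u /existsP[w /and3P[uX wX nuw]]] := sepX.
exists c, u, w, (~: X), [set p | (p \notin X) && connect (edge_in (~: X)) u p].
split.
- split; rewrite ?inE ?cX ?uX ?wX ?connect0 //.
  by apply/subsetP => p; rewrite !inE => /andP[].
- move=> p q; rewrite !inE => pX qX e; rewrite pX qX /=.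
  apply/idP/idP => h; apply: (connect_trans h); apply: connect1 => /=.
    by rewrite /edge_in /= e !inE pX qX.
  by rewrite /edge_in /= edge_sym e !inE pX qX.
- move=> p q; rewrite -cU // !inE => pX qX.
  by apply: separatesPn; rewrite ?nsep // !inE.
(* For i in X, minimality makes the graph induced on U + i connected, so the first edge of a path
   from i to u ends in U. *)
- move=> i; case: (boolP (i \in X)) => iX; last first.
    by exists i; [rewrite !inE iX orbT | left].
  have : connect (edge_in (~: (X :\ i))) i u.
    by apply: separatesPn; rewrite ?nsep // !inE ?eqxx //= negb_and uX orbT.
  case/connectP=> [[|p l] /=]; first by move=> _ e; rewrite e iX in uX.
  rewrite cU // => /andP[/and3P[e _ pU] _] _; exists p; last by right.
  move: pU; rewrite !inE => /orP[/eqP ep|->]; last by rewrite orbT.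
  by rewrite ep edge_irr in e.
Qed.

End Separator.

Section Cone.
Variables (K : fieldType) (T : finType) (H : sgraph T).
Local Notation V := (option T).
Local Notation S := {mpoly K[#|{: V + V}|]}.
Local Notation x := (@xvar K V).
Local Notation y := (@yvar K V).
Local Notation isNone := [pred a : V | a == None].

Definition cone_ideal : {pred S} := bideal pred0 pred0 (cone_edge H).
(* (x_v, y_v) + J_H *)
Definition base_ideal : {pred S} := bideal isNone isNone (cone_edge H).
Local Notation JK := (@det_ideal K V).

Let idG : is_ideal cone_ideal. Proof. exact: bideal_ideal. Qed.
Let idQ : is_ideal base_ideal. Proof. exact: bideal_ideal. Qed.
Let idK : is_ideal JK. Proof. exact: bideal_ideal. Qed.

(** With p = v this multiplies J_K into J_G; with p on a path of H it links the neighbours of p. *)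
Lemma plucker (i j p : V) :
  x p * @minor K V i j = x i * @minor K V p j - x j * @minor K V p i.
Proof. by rewrite /minor; ring. Qed.

Lemma cone_minor (i : V) : @minor K V None i \in cone_ideal.
Proof.
case: i => [i|]; first exact: bideal_minor.
rewrite minor_id; exact: (ideal0 idG).
Qed.

(** An element f of the intersection is stripped of y_v and then of x_v. Modulo J_G + (x_v) it is
    y_v q with q in the ideal of the x_u, and y_v x_u is in J_G + (x_v). So f is x_v p modulo J_G,
    with p in the prime J_K, and x_v J_K lies in J_G by [plucker]. *)
Lemma cone_idealE : cone_ideal = [predI JK & base_ideal].
Proof.
have GK : {subset cone_ideal <= JK}.
  by apply: (bideal_sub idK) => // u w _; apply: bideal_minor.
apply/eq_mem_pred => f; apply/idP/idP.
  move=> fG; apply/andP; split; first exact: GK.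
  apply: (bideal_sub idQ _ _ _ fG) => [//|//|u w e]; exact: bideal_minor.
rewrite inE => /andP[fK fQ].
pose I1 := ideal_gen [predU cone_ideal & [:: x None]].
have id1 : is_ideal I1 by apply: ideal_gen_ideal.
have G1 g : g \in cone_ideal -> g \in I1.
  by move=> gG; apply: mem_ideal_gen; rewrite inE gG.
have x1 : x None \in I1 by apply: mem_ideal_gen; rewrite !inE eqxx orbT.
pose I2 := ideal_gen [predU I1 & [:: y None]].
have id2 : is_ideal I2 by apply: ideal_gen_ideal.
have G2 g : g \in I1 -> g \in I2.
  by move=> gG; apply: mem_ideal_gen; rewrite inE gG.
have y2 : y None \in I2 by apply: mem_ideal_gen; rewrite !inE eqxx orbT.
have f2 : f \in I2.
  apply: (bideal_sub id2 _ _ _ fQ) => [u /eqP->|u /eqP->|u w e].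
  - exact: (G2 _ x1).
  - exact: y2.
  - exact/G2/G1/bideal_minor.
have [q fq] := ideal_add1P id1 f2.
(* J_K is contained in the ideal of the x_u, which is prime. *)
pose X := @linear_ideal K V predT pred0.
have idX : is_ideal X by apply: bideal_ideal.
have KX : {subset JK <= X}.
  apply: (bideal_sub idX) => [//|//|u w _].
  have xX v : x v \in X by apply: bideal_x.
  exact: (idealB idX (ideal_mulr idX _ (xX _)) (ideal_mulr idX _ (xX _))).
have S1X : {subset I1 <= X}.
  apply: (ideal_gen_sub idX) => g; rewrite !inE => /orP[/GK/KX //|/eqP->].
  exact: bideal_x.
have yqX : y None * q \in X by apply: (ideal_eqmod' idX (S1X _ fq) (KX _ fK)).
have qX : q \in X by apply: (linear_ideal_prime yqX); rewrite yvar_linear_ideal.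
have yq1 : y None * q \in I1.
  suff : {subset X <= [pred q | y None * q \in I1]} by move=> /(_ _ qX).
  apply: linear_ideal_sub; [|move=> u _|move=> u; discriminate].
    split; first by rewrite inE mulr0; apply: (ideal0 id1).
    move=> a g h; rewrite !inE mulrDr mulrCA; exact: id1.2.
  rewrite inE; have -> : y None * x u = y u * x None - @minor K V None u.
    by rewrite /minor; ring.
  exact: (idealB id1 (ideal_mull id1 _ x1) (G1 _ (cone_minor u))).
have f1 : f \in I1 by apply: (ideal_eqmod id1 fq yq1).
have [p fp] := ideal_add1P idG f1.
have xpK : x None * p \in JK by apply: (ideal_eqmod' idK (GK _ fp) fK).
have pK : p \in JK.
  rewrite (eq_mem_pred (@det_ideal_onT K V)) in xpK *.
  by apply: (det_ideal_on_prime xpK); rewrite xvar_det_ideal_on inE.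
apply: (ideal_eqmod idG fp).
suff : {subset JK <= [pred p | x None * p \in cone_ideal]} by move=> /(_ _ pK).
apply: bideal_sub; [|move=> u; discriminate|move=> u; discriminate|move=> u w _].
  split; first by rewrite inE mulr0; apply: (ideal0 idG).
  move=> a g h; rewrite !inE mulrDr mulrCA; exact: idG.2.
rewrite inE plucker.
exact: (idealB idG (ideal_mull idG _ (cone_minor _)) (ideal_mull idG _ (cone_minor _))).
Qed.

Lemma base_det_add : ideal_add JK base_ideal = @det_ideal_on K V [set~ None].
Proof.
have idA := ideal_add_ideal JK base_ideal.
have idD : is_ideal (@det_ideal_on K V [set~ None]) by apply: bideal_ideal.
apply/eq_mem_pred => f; apply/idP/idP.
  apply: (ideal_gen_sub idD) => g; rewrite inE => /orP[gK|gQ].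
    apply: (bideal_sub idD _ _ _ gK) => [//|//|u w _]; exact: bideal_minor.
  apply: (bideal_sub idD _ _ _ gQ) => [u /eqP->|u /eqP->|u w _].
  - by apply: bideal_x; rewrite /= !inE eqxx.
  - by apply: bideal_y; rewrite /= !inE eqxx.
  - exact: bideal_minor.
apply: (bideal_sub idA) => [u|u|u w _].
- by rewrite /= !inE negbK => /eqP->; apply/ideal_addr/bideal_x; rewrite /= eqxx.
- by rewrite /= !inE negbK => /eqP->; apply/ideal_addr/bideal_y; rewrite /= eqxx.
- exact/ideal_addl/bideal_minor.
Qed.

Section Transfer.
Variable z : seq S.
Hypothesis zx : forall u, x u \in ideal_span z.
Hypothesis zy : forall u, y u \in ideal_span z.
Hypothesis T0 : (0 < #|T|)%N.

Let depthK : kdepth z JK predT #|T|.+2.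
Proof.
have := @kdepth_det_ideal_on K V z zx zy [set: V].
rewrite cardsT card_option (eq_mem_pred (@det_ideal_onT K V)); apply.
by apply/set0Pn; exists None; rewrite inE.
Qed.

Let depthKQ : kdepth z (ideal_add JK base_ideal) predT #|T|.+1.
Proof.
have := @kdepth_det_ideal_on K V z zx zy [set~ None].
rewrite cardsC1 card_option base_det_add; apply.
by case/card_gt0P: T0 => u _; apply/set0Pn; exists (Some u); rewrite !inE.
Qed.

Let KA : {subset base_ideal <= ideal_add JK base_ideal}.
Proof. exact: ideal_addr. Qed.

(** This lemma and the next three compare (J_K + Q) / Q with S / Q, with cokernel S / (J_K + Q), and
    with S / J_G, with cokernel S / J_K. *)
Lemma kdepth_base_sub k : (k <= #|T|.+2)%N ->
  kdepth z base_ideal predT k -> kdepth z base_ideal (ideal_add JK base_ideal) k.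
Proof.
case: k => [|k] kT h; first exact: kdepth0.
apply: (kdepth_sub idQ _ (@ideal_setT S) KA _ h) => //.
  exact: ideal_add_ideal.
exact: (kdepthW (kT : (k <= #|T|.+1)%N) depthKQ).
Qed.

Lemma kdepth_cone_sub k : (k <= #|T|.+2)%N ->
  kdepth z cone_ideal predT k -> kdepth z base_ideal (ideal_add JK base_ideal) k.
Proof.
case: k => [|k] kT h; first exact: kdepth0.
apply: kdepth_iso' => //; rewrite -cone_idealE.
apply: (kdepth_sub idG idK (@ideal_setT S) _ _ h) => //.
  by move=> f; rewrite cone_idealE => /andP[].
exact: (kdepthW (ltnW kT) depthK).
Qed.

(** The bound is n + 1 instead of n + 2 because vanishing for S / Q is deduced from both outer
    terms, and S / (J_K + Q) provides only n + 1. *)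
Lemma kdepth_sub_base k : (k <= #|T|.+1)%N ->
  kdepth z base_ideal (ideal_add JK base_ideal) k -> kdepth z base_ideal predT k.
Proof.
move=> kT h; apply: (kdepth_ext idQ _ (@ideal_setT S) KA _ h) => //.
  exact: ideal_add_ideal.
exact: (kdepthW kT depthKQ).
Qed.

Lemma kdepth_sub_cone k : (k <= #|T|.+2)%N ->
  kdepth z base_ideal (ideal_add JK base_ideal) k -> kdepth z cone_ideal predT k.
Proof.
move=> kT h; apply: (kdepth_ext idG idK (@ideal_setT S)) => //.
- by move=> f; rewrite cone_idealE => /andP[].
- by rewrite cone_idealE; apply: kdepth_iso.
- exact: (kdepthW kT depthK).
Qed.

End Transfer.

End Cone.

(** * The depth bound *)

Lemma kdepth_nakayama_cat (K : fieldType) n (z1 z2 : seq {mpoly K[n]})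
    (B N : {pred {mpoly K[n]}}) k : is_ideal B -> is_ideal N ->
  homogeneous_ideal B -> homogeneous_ideal N ->
  {in z1 ++ z2, forall b, b \is 1.-homog} ->
  kdepth (z1 ++ z2) B N (size z1 + k) -> kdepth z2 B N k.
Proof.
move=> idB idN hB hN; elim: z1 => [|a z1 IH] hz //= h.
apply: IH; first by move=> b bz; apply: hz; rewrite inE bz orbT.
exact: (kdepth_nakayama idB idN hB hN hz h).
Qed.

Lemma kdepth_cons_injX (R : comNzRingType) (a : R) z B N k i c m :
  is_ideal B -> is_ideal N ->
  kdepth (a :: z) B N k -> (i < k)%N -> kcocycle z B N i c ->
  kcobound z B N i (fun t => a ^+ m * c t) -> kcobound z B N i c.
Proof.
move=> idB idN h ik; elim: m c => [|m IH] c cc hb.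
  by case: hb => b bN bP; exists b => // s ss si; rewrite -[c s]mul1r; apply: bP.
apply: IH => //; apply: (kdepth_cons_inj idB idN h ik).
  case: cc => cN cd; split=> [s|s ss si]; first exact: ideal_mull.
  by rewrite kdZ; apply: ideal_mull => //; apply: cd.
case: hb => b bN bP; exists b => // s ss si.
by rewrite mulrA -exprS; apply: bP.
Qed.

Section NonVanishing.
Variables (K : fieldType) (T : finType) (H : sgraph T).
Local Notation V := (option T).
Local Notation S := {mpoly K[#|{: V + V}|]}.
Local Notation x := (@xvar K V).
Local Notation y := (@yvar K V).
Local Notation Q := (@base_ideal K T H).
Local Notation N := (ideal_add (@det_ideal K V) Q).

Let idQ : is_ideal Q. Proof. exact: bideal_ideal. Qed.
Let idN : is_ideal N. Proof. exact: ideal_add_ideal. Qed.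
Let homQ : homogeneous_ideal Q. Proof. exact: bideal_homogeneous. Qed.
Let homN : homogeneous_ideal N.
Proof. by rewrite base_det_add; apply: bideal_homogeneous. Qed.

Lemma minor_base_None (i : V) : @minor K V None i \in Q.
Proof. by apply: minor_out; rewrite /= eqxx. Qed.

Section Paths.
Variable C : {set T}.
Let M : S := \prod_(k in C) x (Some k).

(* Powers of [M] absorb the repetition of vertices along a path. *)
Let linked (i j : T) : Prop := exists m, M ^+ m * @minor K V (Some i) (Some j) \in Q.

Let linked_edge i j : edge H i j -> linked i j.
Proof. by exists 0%N; rewrite mul1r; apply: bideal_minor. Qed.

Let linked_refl i : linked i i.
Proof. by exists 0%N; rewrite minor_id mulr0; apply: (ideal0 idQ). Qed.

Let linked_sym i j : linked i j -> linked j i.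
Proof.
by case=> m h; exists m; rewrite minorC mulrN; apply: (idealN idQ).
Qed.

(** The relation [plucker] has a factor x_p on the minor of i and j; one more power of [M] supplies
    it. *)
Let linked_trans p i j : p \in C -> linked i p -> linked p j -> linked i j.
Proof.
move=> pC [m hm] [l hl]; exists (m + l).+1.
have -> : M = x (Some p) * \prod_(k in C | k != p) x (Some k) by rewrite /M (bigD1 p).
move: hm hl; rewrite /M (bigD1 p) //=; set P := \prod_(k in _ | _) _ => hm hl.
have -> : (x (Some p) * P) ^+ (m + l).+1 * @minor K V (Some i) (Some j) =
  (P * (x (Some p) * P) ^+ m * x (Some i)) *
     ((x (Some p) * P) ^+ l * @minor K V (Some p) (Some j)) +
  (P * (x (Some p) * P) ^+ l * x (Some j)) *
     ((x (Some p) * P) ^+ m * @minor K V (Some i) (Some p)).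
  have h := plucker K (Some i) (Some j) (Some p).
  rewrite exprS exprD; set A := (_ ^+ m); set B := (_ ^+ l).
  transitivity (P * A * B * (x (Some p) * @minor K V (Some i) (Some j))); first by ring.
  rewrite h (minorC K (Some i) (Some p)); ring.
exact: (idealD idQ (ideal_mull idQ _ hl) (ideal_mull idQ _ hm)).
Qed.

(** Any two vertices are linked along a path in C, prolonged by at most one edge at each end since C
    dominates. The maximum over the finitely many pairs gives a common exponent. *)
Lemma linked_all :
  (forall p q, p \in C -> q \in C -> connect (edge_in H C) p q) ->
  (forall i, exists2 p, p \in C & i = p \/ edge H i p) ->
  exists m, forall i j : T,
    (\prod_(k in C) x (Some k)) ^+ m * @minor K V (Some i) (Some j) \in Q.
Proof.
move=> Cconn Cdom.
have linkC p q : p \in C -> q \in C -> linked p q.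
  move=> pC qC; case/connectP: (Cconn p q pC qC) => l hl ->.
  elim: l p pC hl {q qC} => [|q l IH] p pC /=; first by move=> _; apply: linked_refl.
  case/andP=> /and3P[e _ qC] hl; apply: (linked_trans qC); first exact: linked_edge.
  exact: IH.
have link i j : linked i j.
  have [p pC ip] := Cdom i; have [q qC jq] := Cdom j.
  apply: (linked_trans pC).
    by case: ip => [->|/linked_edge].
  apply: (linked_trans qC); first exact: linkC.
  by case: jq => [->|/linked_edge/linked_sym].
have : forall ij : T * T, exists m,
  M ^+ m * @minor K V (Some ij.1) (Some ij.2) \in Q by move=> ij; apply: link.
move=> /choice[m mP]; exists (\max_ij m ij)%N => i j.
have le := leq_bigmax (i, j) : (m (i, j) <= \max_ij m ij)%N.
rewrite -(subnK le) exprD -mulrA; exact: (ideal_mull idQ _ (mP (i, j))).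
Qed.

End Paths.

(* The Koszul 1-cochain y_v |-> x_v. *)
Fixpoint xi (vs : seq V) (s : seq bool) : S :=
  match vs, s with
  | v :: _, true :: _ => x v
  | _ :: vs', false :: s' => xi vs' s'
  | _, _ => 0
  end.

Lemma kd_const1 vs (c : S) s : size s = size vs -> count id s = 1%N ->
  exists2 j, xi vs s = x j & kd (map y vs) (fun=> c) s = c * y j.
Proof.
elim: vs s => [|v vs IH] [|[] s] //= [ss] si; last exact: IH.
exists v => //; rewrite kd_deg0 ?subr0 1?mulrC //.
by case: si.
Qed.

Lemma kd_xi vs s : size s = size vs -> count id s = 2%N ->
  exists i j, kd (map y vs) (xi vs) s = @minor K V i j.
Proof.
elim: vs s => [|v vs IH] [|[] s] //= [ss] si; last exact: IH.
have [|j xj kj] := kd_const1 (x v) ss; first by case: si.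
by exists j, v; rewrite kj xj /minor mulrC.
Qed.

Section Cocycle.
Variables (c u w : T) (U A : {set T}) (m : nat).
Hypotheses (cU : c \notin U) (uA : u \in A) (AU : A \subset U)
  (wU : w \in U) (wA : w \notin A).
Hypothesis noedge : forall p q, p \in U -> q \in U -> edge H p q -> (p \in A) = (q \in A).
Hypothesis killed : forall i j : T,
  (\prod_(k in c |: U) x (Some k)) ^+ m * @minor K V (Some i) (Some j) \in Q.

(** u and w are repeated at the front so that an explicit string selects the pair. *)
Let vs : seq V := [:: Some u, Some w & map Some (enum T)].
Let ys : seq S := map y vs.
Let g : S := (\prod_(k in U) x (Some k)) ^+ m.

Let kmult : x (Some c) ^+ m * g = (\prod_(k in c |: U) x (Some k)) ^+ m.
Proof. by rewrite big_setU1 //= exprMn. Qed.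

Let killedV (i j : V) : x (Some c) ^+ m * (g * @minor K V i j) \in Q.
Proof.
rewrite mulrA kmult; case: i j => [i|] [j|]; first exact: killed.
- by rewrite minorC mulrN; apply: (idealN idQ); apply: (ideal_mull idQ _ (minor_base_None _)).
- exact: (ideal_mull idQ _ (minor_base_None _)).
- exact: (ideal_mull idQ _ (minor_base_None _)).
Qed.

(** A point over K[t]: its columns are (1, t) on A, (1, 0) on the rest of U, and (0, 0)
    elsewhere. *)
Let al (v : V) : {poly K} := if v is Some k then (k \in U)%:R else 0.
Let be (v : V) : {poly K} := if v is Some k then (k \in A)%:R * 'X else 0.
Let phi : {rmorphism S -> {poly K}} := ev (@polyC K) al be.

Let phi_x v : phi (x v) = al v. Proof. exact: ev_x. Qed.
Let phi_y v : phi (y v) = be v. Proof. exact: ev_y. Qed.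

Let phi_minor i j : phi (@minor K V i j) = al i * be j - al j * be i.
Proof.
by rewrite /minor rmorphB (rmorphM phi (x i)) (rmorphM phi (x j)) !phi_x !phi_y.
Qed.

Let AsubU k : k \in A -> k \in U. Proof. exact: (subsetP AU). Qed.

(** The ends of an edge inside U have equal columns, since both or neither are in A; an end outside
    U has a zero column. *)
Let phiQ f : f \in Q -> phi f = 0.
Proof.
suff : {subset Q <= [pred f | phi f == 0]} by move=> h /h /eqP.
apply: bideal_sub; first exact: ker_ideal.
- by move=> v /eqP->; rewrite inE phi_x.
- by move=> v /eqP->; rewrite inE phi_y.
move=> [i|] [j|] //=; rewrite inE phi_minor /al /be ?(mul0r, mulr0, subr0) // => e.
case: (boolP (i \in U)) => iU; case: (boolP (j \in U)) => jU /=.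
- by rewrite (noedge iU jU e) subrr.
- by rewrite (contraNF (@AsubU j)) // !(mul0r, mulr0, subrr).
- by rewrite (contraNF (@AsubU i)) // !(mul0r, mulr0, subrr).
- by rewrite !mul0r subrr.
Qed.

(** At t = 0 the whole second row vanishes, and with it every minor. *)
Let phiN f : f \in N -> (phi f).[0] = 0.
Proof.
suff : {subset N <= [pred f | (horner_eval 0 \o phi) f == 0]} by move=> h /h /eqP.
apply: ideal_gen_sub; first exact: ker_ideal.
move=> f'; rewrite inE => /orP[|/phiQ e]; last by rewrite inE /= e rmorph0.
apply: bideal_sub; first exact: ker_ideal.
- by move=> v; discriminate.
- by move=> v; discriminate.
move=> i j _; rewrite inE /= phi_minor /horner_eval.
have be0 v : (be v).[0] = 0 by case: v => [v|]; rewrite /be ?horner0 // hornerM hornerX mulr0.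
by rewrite hornerD hornerN !hornerM !be0 !mulr0 subr0.
Qed.

Let phi_g : phi g = 1.
Proof.
rewrite rmorphXn rmorph_prod big1 ?expr1n // => k kU.
by rewrite /= phi_x /al kU.
Qed.

(* This cocycle would be the coboundary of [g] times [xi], if the values of [xi]
   belonged to [N]. *)
Let kxi s := if (size s == size ys) && (count id s == 2%N) then g * kd ys (xi vs) s else 0.

Let kxi_cocycle : kcocycle ys Q N 2 kxi.
Proof.
split=> [s|s ss si].
  rewrite /kxi; case: ifP => [/andP[/eqP ss /eqP si]|_]; last exact: (ideal0 idN).
  have ss' : size s = size vs by rewrite ss size_map.
  have [i [j ->]] := kd_xi ss' si.
  by apply: (ideal_mull idN); apply/ideal_addl/bideal_minor.
have -> : kd ys kxi s = kd ys (fun t => g * kd ys (xi vs) t) s.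
  by apply: eq_kd_deg => // t st; rewrite si => -[ti]; rewrite /kxi st ti !eqxx.
by rewrite kdZ kdK mulr0; apply: (ideal0 idQ).
Qed.

Let kxi_not_cobound : ~ kcobound ys Q N 2 kxi.
Proof.
case=> b bN /(_ (true :: true :: nseq (size (enum T)) false)).
rewrite /kxi /= !size_map size_nseq eqxx.
have c0 n : count id (nseq n false) = 0%N by elim: n.
rewrite c0 => /(_ erefl erefl) /phiQ.
rewrite !kd_deg0 ?c0 // !subr0 !rmorphB !rmorphM /= phi_g mul1r.
have alu : al (Some u) = 1 by rewrite /al AsubU.
have alw : al (Some w) = 1 by rewrite /al wU.
have beu : be (Some u) = 'X by rewrite /be uA mul1r.
have bew : be (Some w) = 0 by rewrite /be (negbTE wA) mul0r.
rewrite !rmorphB !rmorphM !phi_x !phi_y alu alw beu bew.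
rewrite !(mul0r, mul1r, subr0, mulr1, oppr0).
(* [b1] is the value at y_w. The image of the bounding equation reads t = t * [phi b1], which forces
   [phi b1] = 1, whereas it must vanish at t = 0. *)
set b1 := b _; move=> /eqP; rewrite -[X in X - _]mulr1 -mulrBr mulf_eq0 polyX_eq0 /=.
rewrite subr_eq0 => /eqP/esym e; have := phiN (bN _ : b1 \in N).
have -> : phi b1 = 1 by exact: e.
by rewrite hornerC => /eqP; rewrite oner_eq0.
Qed.

(** Vanishing up to degree 2 would make x_c injective on H^2 of [ys], but a power of x_c kills the
    nonzero class of [kxi]. *)
Lemma not_kdepth_cocycle : ~ kdepth (x (Some c) :: ys) Q N 3.
Proof.
move=> h; apply: kxi_not_cobound.
apply: (kdepth_cons_injX (m := m) idQ idN h _ kxi_cocycle) => //.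
exists (fun=> 0) => [s|s ss si]; first exact: (ideal0 idN).
have ss' : size s = size vs by rewrite ss size_map.
have [i [j e]] := kd_xi ss' si.
have -> : kxi s = g * @minor K V i j by rewrite /kxi ss si !eqxx -e.
rewrite kd0 subr0; exact: killedV.
Qed.

End Cocycle.

Lemma not_kdepth_base : connected_graph H -> ~ complete_graph H ->
  exists z, [/\ forall v, x v \in z, forall v, y v \in z, {in z, forall f, f \is 1.-homog} &
    ~ kdepth z Q N #|T|.+2].
Proof.
move=> Hconn Hnc.
have [c [u [w [U [A [[cU uA AU wU wA] noedge Cconn Cdom]]]]]] :=
  minimal_separator Hconn Hnc.
have [m killed] := linked_all Cconn Cdom.
pose xs := [seq x (Some k) | k <- enum T & k != c].
pose ys := map y [:: Some u, Some w & map Some (enum T)].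
pose z := [:: x None, y None & xs ++ x (Some c) :: ys].
have hom : {in z, forall f, f \is 1.-homog}.
  have hx v : x v \is 1.-homog by apply: xvar_homog.
  have hy v : y v \is 1.-homog by apply: yvar_homog.
  move=> f; rewrite !inE mem_cat inE => /or3P[/eqP->//|/eqP->//|].
  case/or3P=> [/mapP[k _ ->]//|/eqP->//|/mapP[k _ ->]//].
exists z; split=> //.
- case=> [k|]; last by rewrite !inE eqxx.
  have [->|kc] := eqVneq k c.
    by rewrite !inE mem_cat inE eqxx !orbT.
  have xk : x (Some k) \in xs.
    by apply/mapP; exists k => //; rewrite mem_filter kc mem_enum.
  by rewrite !inE mem_cat xk !orbT.
- case=> [k|]; last by rewrite !inE eqxx orbT.
  have yk : y (Some k) \in ys.
    by apply: map_f; rewrite !inE (map_f Some (mem_enum T k)) !orbT.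
  by rewrite !inE mem_cat inE yk !orbT.
- have killN v : x None * v \in Q /\ y None * v \in Q.
    split; apply: (ideal_mulr idQ); [apply: bideal_x | apply: bideal_y]; by rewrite /= eqxx.
  move=> /(kdepth_behead idQ idN (kkills_ann _ (fun v _ => (killN v).1))).
  move=> /(kdepth_behead idQ idN (kkills_ann _ (fun v _ => (killN v).2))) h.
  (* Removing the n - 1 variables x_k with k different from c leads from n + 2 down to 3. *)
  have szxs : (size xs + 3 = #|T|.+2)%N.
    have := count_predC (pred1 c) (enum T).
    rewrite count_uniq_mem ?enum_uniq // mem_enum -cardE => <-.
    by rewrite size_map size_filter add1n addn3; congr _.+3; apply: eq_count.
  rewrite -szxs in h.
  apply: (not_kdepth_cocycle cU uA AU wU wA noedge killed).
  apply: (kdepth_nakayama_cat idQ idN homQ homN _ h).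
  by move=> f fz; apply: hom; rewrite /z !inE fz !orbT.
Qed.

End NonVanishing.

(** * Restriction to the base of the cone *)

Section Surjection.
Variables (R R' : comNzRingType) (F : {rmorphism R -> R'}).
Hypothesis Fsurj : forall b, exists a, F a = b.
Variables (I : {pred R}) (I' : {pred R'}).
Hypotheses (idI' : is_ideal I') (IE : forall f, (f \in I) = (F f \in I')).

(** By [IE] and surjectivity F induces an isomorphism of R / I with R' / I', so ideals above I
    correspond to ideals above I'. *)
Lemma ideal_gen_preim s f :
  (f \in ideal_gen [predU I & s]) = (F f \in ideal_gen [predU I' & map F s]).
Proof.
have id1 := ideal_gen_ideal [predU I & s].
have id2 := ideal_gen_ideal [predU I' & map F s].
apply/idP/idP.
  suff : {subset ideal_gen [predU I & s] <=
    [pred f | F f \in ideal_gen [predU I' & map F s]]} by move=> h /h.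
  apply: ideal_gen_sub.
    split; first by rewrite inE rmorph0; apply: (ideal0 id2).
    by move=> a g h; rewrite !inE rmorphD rmorphM; apply: id2.2.
  move=> g; rewrite !inE => hg; apply: mem_ideal_gen; rewrite inE.
  by case/orP: hg => [gI|gs]; rewrite -?IE ?gI // map_f ?orbT.
move=> Ff.
have [h hI Fh] : exists2 h, h \in ideal_gen [predU I & s] & F h = F f.
  suff : {subset ideal_gen [predU I' & map F s] <=
    [pred b | `[< exists2 h, h \in ideal_gen [predU I & s] & F h = b >]]}.
    by move=> /(_ _ Ff) /asboolP.
  apply: ideal_gen_sub.
    split; first by apply/asboolP; exists 0; [apply: (ideal0 id1) | rewrite rmorph0].
    move=> a _ _ /asboolP[g gI <-] /asboolP[h hI <-]; have [b <-] := Fsurj a.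
    apply/asboolP; exists (b * g + h); first exact: id1.2.
    by rewrite rmorphD rmorphM.
  move=> b; rewrite inE => /orP[bI|/mapP[a as_ ->]]; apply/asboolP.
    have [a ab] := Fsurj b; exists a => //; apply: mem_ideal_gen.
    by rewrite inE IE ab bI.
  by exists a => //; apply: mem_ideal_gen; rewrite inE as_ orbT.
rewrite -(subrK h f); apply: (idealD id1) => //; apply: mem_ideal_gen.
by rewrite inE IE rmorphB Fh subrr (ideal0 idI').
Qed.

Lemma regular_seq_preim s : regular_seq I s <-> regular_seq I' (map F s).
Proof.
split=> -[h1 h2]; (split; last by move: h2; rewrite ideal_gen_preim rmorph1).
- move=> i; rewrite size_map => si g'; have [g <-] := Fsurj g'.
  rewrite (nth_map 0) // -rmorphM -map_take -!ideal_gen_preim; exact: h1.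
- move=> i si g; have := h1 i; rewrite size_map => /(_ si (F g)).
  by rewrite (nth_map 0) // -rmorphM -map_take -!ideal_gen_preim.
Qed.

Lemma has_regular_seq_preim (m : {pred R}) (m' : {pred R'}) k :
  (forall f, (f \in m) = (F f \in m')) ->
  has_regular_seq m I k <-> has_regular_seq m' I' k.
Proof.
move=> mE; split=> [[s [sk sm rs]]|[s [sk sm rs]]].
  exists (map F s); split; rewrite ?size_map //.
    by move=> _ /mapP[f fs ->]; rewrite -mE; apply: sm.
  exact/regular_seq_preim.
have /choice[G GK] : forall b, exists a, F a = b by [].
exists (map G s); split; rewrite ?size_map //.
  by move=> _ /mapP[f fs ->]; rewrite mE GK; apply: sm.
apply/regular_seq_preim; suff -> : map F (map G s) = s by [].
by rewrite -map_comp -[RHS]map_id; apply: eq_map => b /=.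
Qed.

End Surjection.

Section MaxIdeal.
Variables (K : fieldType) (V : finType).
Local Notation S := {mpoly K[#|{: V + V}|]}.
Local Notation x := (@xvar K V).
Local Notation y := (@yvar K V).
Local Notation m := (@graded_max_ideal K V).

Lemma mcoeff0_x u : (x u)@_0%MM = 0.
Proof.
by apply: (dhomog_nemf_coeff (xvar_homog K u)); rewrite /= mdeg0.
Qed.

Lemma mcoeff0_y u : (y u)@_0%MM = 0.
Proof.
by apply: (dhomog_nemf_coeff (yvar_homog K u)); rewrite /= mdeg0.
Qed.

Lemma max_ideal_ideal : is_ideal m.
Proof.
split; first by rewrite inE mcoeff0.
move=> a f g; rewrite !inE mcoeffD (rmorphM (mcoeff 0%MM)) /= => /eqP-> /eqP->.
by rewrite mulr0 addr0.
Qed.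

Lemma max_ideal1 : 1 \notin m.
Proof. by rewrite inE mcoeff1 eqxx oner_eq0. Qed.

Lemma max_ideal_homog f : f \is 1.-homog -> f \in m.
Proof. by move=> hf; rewrite inE (dhomog_nemf_coeff hf) //= mdeg0. Qed.

Lemma max_idealE : m =i @linear_ideal K V predT predT.
Proof.
move=> f; rewrite linear_idealE inE.
suff -> : kill predT predT f = (f@_0%MM)%:MP by rewrite mpolyC_eq0.
elim/mpoly_xy_ind: f => [c|u|u|p q hp hq|p q hp hq].
- by rewrite /kill evC mcoeffC eqxx mulr1.
- by rewrite kill_x mcoeff0_x mpolyC0.
- by rewrite kill_y mcoeff0_y mpolyC0.
- by rewrite rmorphD /= hp hq mcoeffD mpolyCD.
- by rewrite (rmorphM (kill _ _)) /= hp hq (rmorphM (mcoeff 0%MM)) mpolyCM.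
Qed.

Lemma bideal_max_ideal Zx Zy E : {subset @bideal K V Zx Zy E <= m}.
Proof.
have idm := max_ideal_ideal.
have xm u : x u \in m by rewrite inE mcoeff0_x.
apply: (bideal_sub idm) => [u _|u _|u w _].
- exact: xm.
- by rewrite inE mcoeff0_y.
- exact: (idealB idm (ideal_mulr idm _ (xm _)) (ideal_mulr idm _ (xm _))).
Qed.

Variable z : seq S.
Hypotheses (zx : forall u, x u \in z) (zy : forall u, y u \in z)
  (zh : {in z, forall f, f \is 1.-homog}).

Lemma max_ideal_span : {subset m <= ideal_span z}.
Proof.
move=> f; rewrite max_idealE; apply: linear_ideal_sub.
- exact: ideal_gen_ideal.
- by move=> u _; apply: mem_ideal_gen; rewrite inE; apply: zx.
- by move=> u _; apply: mem_ideal_gen; rewrite inE; apply: zy.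
Qed.

(** The bridge between regular sequences and Koszul vanishing, for any list of linear forms
    containing the variables, repetitions allowed. *)
Lemma has_regular_seqE I k : is_ideal I -> {subset I <= m} ->
  has_regular_seq m I k <-> kdepth z I predT k.
Proof.
move=> idI Im; split; first exact: (has_regular_seq_kdepth idI max_ideal_span).
move=> h; apply: (kdepth_has_regular_seq (@noetherian_mpoly K _) idI max_ideal_ideal Im max_ideal1 _ h).
by move=> f fz; apply: max_ideal_homog; apply: zh.
Qed.

End MaxIdeal.

Section Restriction.
Variables (K : fieldType) (T : finType) (H : sgraph T).
Local Notation V := (option T).
Local Notation S := {mpoly K[#|{: V + V}|]}.
Local Notation SH := {mpoly K[#|{: T + T}|]}.
Local Notation J := (@binomial_edge_ideal K T H).
Local Notation Q := (@base_ideal K T H).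

Definition restr : S -> SH := ev (@mpolyC _ K)
  (fun v => if v is Some u then xvar K u else 0)
  (fun v => if v is Some u then yvar K u else 0).

HB.instance Definition _ := GRing.RMorphism.on restr.

Definition extend : SH -> S := ev (@mpolyC _ K)
  (fun u => xvar K (Some u)) (fun u => yvar K (Some u)).

HB.instance Definition _ := GRing.RMorphism.on extend.

Lemma restrC c : restr c%:MP = c%:MP. Proof. exact: evC. Qed.

Lemma restr_x v : restr (xvar K v) = if v is Some u then xvar K u else 0.
Proof. exact: ev_x. Qed.

Lemma restr_y v : restr (yvar K v) = if v is Some u then yvar K u else 0.
Proof. exact: ev_y. Qed.

Lemma extendC c : extend c%:MP = c%:MP. Proof. exact: evC. Qed.

Lemma extend_x u : extend (xvar K u) = xvar K (Some u).
Proof. exact: ev_x. Qed.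

Lemma extend_y u : extend (yvar K u) = yvar K (Some u).
Proof. exact: ev_y. Qed.

Lemma extendK : cancel extend restr.
Proof.
elim/mpoly_xy_ind => [c|u|u|p q hp hq|p q hp hq].
- by rewrite extendC restrC.
- by rewrite extend_x restr_x.
- by rewrite extend_y restr_y.
- by rewrite !rmorphD /= hp hq.
- by rewrite (rmorphM extend) (rmorphM restr) /= hp hq.
Qed.

Lemma restr_surj f : exists g, restr g = f.
Proof. by exists (extend f); apply: extendK. Qed.

(** [f] and [extend (restr f)] agree modulo Q, so [restr] identifies S / Q with S_H / J_H. *)
Lemma base_idealE f : (f \in Q) = (restr f \in J).
Proof.
have idQ : is_ideal Q by apply: bideal_ideal.
have idJ : is_ideal J by apply: ideal_gen_ideal.
have JB := eq_mem_pred (@bideal_edge K T H).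
apply/idP/idP => h.
  suff : {subset Q <= [pred f | restr f \in J]} by move=> /(_ _ h).
  apply: bideal_sub.
  - split; first by rewrite inE rmorph0; apply: (ideal0 idJ).
    by move=> a g g'; rewrite !inE rmorphD (rmorphM restr); apply: idJ.2.
  - by move=> u /eqP->; rewrite inE restr_x; apply: (ideal0 idJ).
  - by move=> u /eqP->; rewrite inE restr_y; apply: (ideal0 idJ).
  - move=> u w e; rewrite inE /minor rmorphB /= !(rmorphM restr) /= !restr_x !restr_y.
    case: u w e => [u|] [w|] //= e; rewrite ?mul0r ?mulr0 ?subr0; try exact: (ideal0 idJ).
    by rewrite -/(@minor K T u w) JB; apply: bideal_minor.
have fQ : f - extend (restr f) \in Q.
  elim/mpoly_xy_ind: f {h} => [c|[u|]|[u|]|p q hp hq|p q hp hq].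
  - by rewrite restrC extendC subrr; apply: (ideal0 idQ).
  - by rewrite restr_x extend_x subrr; apply: (ideal0 idQ).
  - by rewrite restr_x rmorph0 subr0; apply: bideal_x; rewrite /= eqxx.
  - by rewrite restr_y extend_y subrr; apply: (ideal0 idQ).
  - by rewrite restr_y rmorph0 subr0; apply: bideal_y; rewrite /= eqxx.
  - by rewrite !rmorphD /= opprD addrACA; exact: (idealD idQ hp hq).
  - rewrite (rmorphM restr) (rmorphM extend) /=.
    have -> : p * q - extend (restr p) * extend (restr q) =
      p * (q - extend (restr q)) + (p - extend (restr p)) * extend (restr q).
      by rewrite mulrBr mulrBl addrA subrK.
    exact: (idealD idQ (ideal_mull idQ _ hq) (ideal_mulr idQ _ hp)).
rewrite -(subrK (extend (restr f)) f); apply: (idealD idQ fQ).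
suff : {subset J <= [pred g | extend g \in Q]} by move=> /(_ _ h).
rewrite JB; apply: bideal_sub.
- split; first by rewrite inE rmorph0; apply: (ideal0 idQ).
  by move=> a g g'; rewrite !inE rmorphD (rmorphM extend); apply: idQ.2.
- by move=> u; discriminate.
- by move=> u; discriminate.
- move=> u w e; rewrite inE /minor rmorphB /= !(rmorphM extend) /= !extend_x !extend_y.
  by rewrite -/(@minor K V (Some u) (Some w)); apply: bideal_minor.
Qed.

Lemma restr_max_ideal f :
  (f \in @graded_max_ideal K V) = (restr f \in @graded_max_ideal K T).
Proof.
rewrite !inE; congr (_ == 0).
elim/mpoly_xy_ind: f => [c|[u|]|[u|]|p q hp hq|p q hp hq].
- by rewrite restrC !mcoeffC !eqxx.
- by rewrite restr_x !mcoeff0_x.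
- by rewrite restr_x mcoeff0_x mcoeff0.
- by rewrite restr_y !mcoeff0_y.
- by rewrite restr_y mcoeff0_y mcoeff0.
- by rewrite (rmorphD restr) /= !mcoeffD hp hq.
- by rewrite (rmorphM restr) /= !(rmorphM (mcoeff 0%MM)) /= hp hq.
Qed.

Lemma cone_idealP : @binomial_edge_ideal K V (cone H) = @cone_ideal K T H.
Proof. exact: (eq_mem_pred (@bideal_edge K V (cone H))). Qed.

Hypotheses (Hconn : connected_graph H) (Hnc : ~ complete_graph H).

Lemma has_regular_seq_cone k :
  has_regular_seq (@graded_max_ideal K V) (@binomial_edge_ideal K V (cone H)) k <->
  has_regular_seq (@graded_max_ideal K T) J k.
Proof.
have [z [zx zy zh nz]] := @not_kdepth_base K T H Hconn Hnc.
have idQ : is_ideal Q by apply: bideal_ideal.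
have idJ : is_ideal J by apply: ideal_gen_ideal.
have idC : is_ideal (@cone_ideal K T H) by apply: bideal_ideal.
(* The graph without vertices counts as complete. *)
have T0 : (0 < #|T|)%N.
  rewrite lt0n; apply/eqP => T0; apply: Hnc => u; have := card0_eq T0 u.
  by rewrite inE.
rewrite cone_idealP (has_regular_seqE zx zy zh _ idC); last exact: bideal_max_ideal.
rewrite -(has_regular_seq_preim restr_surj idJ base_idealE _ restr_max_ideal).
rewrite (has_regular_seqE zx zy zh _ idQ); last exact: bideal_max_ideal.
have spanx v : xvar K v \in ideal_span z by apply: mem_ideal_gen; rewrite inE.
have spany v : yvar K v \in ideal_span z by apply: mem_ideal_gen; rewrite inE.
(* Up to n + 1 both sides are equivalent to vanishing for (J_K + Q) / Q; from n + 2 on both are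
   impossible. *)
case: (leqP k #|T|.+1) => kT; split=> h.
- by apply: (kdepth_sub_base spanx spany T0 kT); apply: (kdepth_cone_sub spanx spany) => //;
    apply: leq_trans kT _.
- by apply: (kdepth_sub_cone spanx spany); [apply: leq_trans kT _ |
    apply: (kdepth_base_sub spanx spany T0) => //; apply: leq_trans kT _].
- by case: nz; apply: (kdepth_cone_sub spanx spany) => //; apply: kdepthW kT h.
- by case: nz; apply: (kdepth_base_sub spanx spany T0) => //; apply: kdepthW kT h.
Qed.

(** This bound makes the depth exist as a maximum, and later pins down the dimension in the
    Cohen-Macaulay case. *)
Lemma has_regular_seq_bound k :
  has_regular_seq (@graded_max_ideal K T) J k -> (k <= #|T|.+1)%N.
Proof.
have [z [zx zy zh nz]] := @not_kdepth_base K T H Hconn Hnc.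
have idC : is_ideal (@cone_ideal K T H) by apply: bideal_ideal.
rewrite -has_regular_seq_cone cone_idealP (has_regular_seqE zx zy zh _ idC); last first.
  exact: bideal_max_ideal.
have spanx v : xvar K v \in ideal_span z by apply: mem_ideal_gen; rewrite inE.
have spany v : yvar K v \in ideal_span z by apply: mem_ideal_gen; rewrite inE.
move=> h; rewrite leqNgt; apply/negP => kT.
by case: nz; apply: (kdepth_cone_sub spanx spany) => //; apply: kdepthW kT h.
Qed.

Lemma graph_depth_cone d : graph_depth K (cone H) d <-> graph_depth K H d.
Proof.
by split=> -[h1 h2]; (split; first exact/has_regular_seq_cone) => e;
  rewrite -/(has_regular_seq _ _ e) => /has_regular_seq_cone; apply: h2.
Qed.

Lemma graph_depth_exists : exists d, graph_depth K H d.
Proof.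
pose P k := `[< has_regular_seq (@graded_max_ideal K T) J k >].
have exP : exists k, P k.
  exists 0%N; apply/asboolP; exists [::]; split=> //; split=> //.
  rewrite ideal_gen_id; last exact: ideal_gen_ideal.
  apply: contra (max_ideal1 K T) => h.
  by apply: (@bideal_max_ideal K T pred0 pred0 (edge H)); rewrite -bideal_edge.
have bP k : P k -> (k <= #|T|.+1)%N by move=> /asboolP; apply: has_regular_seq_bound.
have [d /asboolP Pd maxd] := ex_maxnP exP bP.
by exists d; split=> // e he; apply: maxd; apply/asboolP.
Qed.

End Restriction.

(** * Dimension *)

Fixpoint exponents (N l : nat) : seq (seq nat) :=
  if l is l'.+1 then [seq j :: e | j <- index_iota 0 N, e <- exponents N l']
  else [:: [::]].

Lemma size_exponents N l : size (exponents N l) = (N ^ l)%N.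
Proof. by elim: l => [//|l IH] /=; rewrite size_allpairs size_iota subn0 IH expnS. Qed.

Lemma exponents_uniq N l : uniq (exponents N l).
Proof.
elim: l => [//|l IH] /=; apply: allpairs_uniq => //; first exact: iota_uniq.
by move=> [j e] [j' e'] _ _ [-> ->].
Qed.

Section Monomials.
Variables (K : fieldType) (R : comNzRingType) (k : {rmorphism K -> R}).
Implicit Types (l : seq R) (c : seq nat -> K) (e : seq nat) (P : nat -> {pred R}).

Fixpoint monom l e : R :=
  match l, e with
  | a :: l', j :: e' => a ^+ j * monom l' e'
  | _, _ => 1
  end.

Definition msum N l c : R := \sum_(e <- exponents N (size l)) k (c e) * monom l e.

Lemma msum_cons N a l c :
  msum N (a :: l) c = \sum_(0 <= j < N) a ^+ j * msum N l (fun e => c (j :: e)).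
Proof.
rewrite /msum /= big_allpairs_dep; apply: eq_bigr => j _; rewrite mulr_sumr.
by apply: eq_bigr => e _; rewrite mulrCA.
Qed.

Lemma prime_ideal_ideal (P : {pred R}) : prime_ideal P -> is_ideal P.
Proof. by case=> -[P0 _ PD] _; split=> // a f g; apply: PD. Qed.

Lemma prime_idealM (P : {pred R}) f g :
  prime_ideal P -> f * g \in P -> f \notin P -> g \in P.
Proof. by case=> _ Pp /Pp /orP[->|->]. Qed.

Lemma prime_idealX (P : {pred R}) f j : prime_ideal P -> f \notin P -> f ^+ j \notin P.
Proof.
move=> PP nf; elim: j => [|j IH]; first by case: PP => -[].
by rewrite exprS; apply/negP => /(prime_idealM PP) /(_ nf); apply/negP.
Qed.

(* Dividing by the smallest power of the head of [l] that occurs in the relation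
   leaves a relation between the other elements, modulo [P 1]. *)
Lemma prime_chain_independent N l c P :
  (forall i, (i <= size l)%N -> prime_ideal (P i)) ->
  (forall i, (i < size l)%N ->
     [/\ {subset P i <= P i.+1}, l`_i \in P i.+1 & l`_i \notin P i]) ->
  msum N l c \in P 0%N -> forall e, e \in exponents N (size l) -> c e = 0.
Proof.
elim: l c P => [|a l IH] c P Pprime Pl.
  rewrite /msum /= big_seq1 mulr1 => h e; rewrite inE => /eqP->.
  apply/eqP/negPn/negP => c0; have P0 := Pprime 0%N isT.
  case: (P0) => -[_ /negP n1 _] _; apply: n1.
  rewrite -(rmorph1 k) -(mulVf c0) rmorphM.
  exact: (ideal_mull (prime_ideal_ideal P0)).
rewrite msum_cons => h.
have P0 := Pprime 0%N isT; have P1 := Pprime 1%N isT.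
have [P01 aP1 aP0] := Pl 0%N isT.
have id0 := prime_ideal_ideal P0; have id1 := prime_ideal_ideal P1.
suff main j : (j < N)%N -> forall e, e \in exponents N (size l) -> c (j :: e) = 0.
  move=> e /allpairsP[[j e'] /= [jN e'l ->]]; apply: main => //.
  by move: jN; rewrite mem_index_iota.
elim/ltn_ind: j => j IHj jN.
apply: (IH _ (fun i => P i.+1)).
- by move=> i il; apply: Pprime.
- by move=> i il; apply: (Pl i.+1).
(* The terms before j vanish by induction; the rest is divisible by [a ^+ j], which is not in the
   prime [P 0]. *)
move: h; rewrite (big_cat_nat (n := j)) //=; last exact: ltnW.
rewrite big1_seq ?add0r; last first.
  move=> i; rewrite mem_index_iota => /= ij; rewrite /msum big1_seq ?mulr0 //.
  by move=> e /= el; rewrite IHj ?rmorph0 ?mul0r // (ltn_trans ij jN).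
rewrite big_ltn //.
have -> : \sum_(j.+1 <= i < N) a ^+ i * msum N l (fun e => c (i :: e)) =
  a ^+ j * (a * \sum_(j.+1 <= i < N) a ^+ (i - j.+1) * msum N l (fun e => c (i :: e))).
  rewrite !mulr_sumr; apply: eq_big_nat => i /andP[ji _].
  by rewrite !mulrA -exprSr -exprD subnKC.
rewrite -mulrDr => /(prime_idealM P0) /(_ (prime_idealX j P0 aP0)) /P01 h.
rewrite -[msum _ _ _](addrK (a * \sum_(j.+1 <= i < N) a ^+ (i - j.+1) *
  msum N l (fun e => c (i :: e)))).
by apply: (idealB id1 h); apply: (ideal_mulr id1).
Qed.

End Monomials.

Lemma rmorph_msum (K : fieldType) (R R' : comNzRingType) (k : {rmorphism K -> R})
    (k' : {rmorphism K -> R'}) (F : {rmorphism R -> R'}) N l c :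
  (forall a, F (k a) = k' a) -> F (msum k N l c) = msum k' N (map F l) c.
Proof.
move=> Fk; rewrite /msum rmorph_sum size_map; apply: eq_bigr => e _.
rewrite rmorphM Fk; congr (_ * _).
elim: l e => [|a l IH] [|j e] /=; rewrite ?rmorph1 //.
by rewrite rmorphM rmorphXn IH.
Qed.

Section AlgebraicDependence.
Variables (K : fieldType) (n : nat).
Implicit Types (p q : {mpoly K[n]}) (l : seq {mpoly K[n]}).

Let deg_le d p : Prop := forall m, m \in msupp p -> (mdeg m <= d)%N.

Let deg_leM d d' p q : deg_le d p -> deg_le d' q -> deg_le (d + d') (p * q).
Proof.
move=> hp hq m /msuppM_le /allpairsP[[m1 m2] /= [h1 h2 ->]].
by rewrite mdegD leq_add // ?hp ?hq.
Qed.

Let deg_leX d p j : deg_le d p -> deg_le (j * d) (p ^+ j).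
Proof.
move=> hp; elim: j => [|j IH]; last by rewrite exprS mulSn; apply: deg_leM.
by move=> m; rewrite expr0 msupp1 inE => /eqP->; rewrite mdeg0.
Qed.

Let deg_le_monom d N l e : (forall p, p \in l -> deg_le d p) ->
  e \in exponents N (size l) -> deg_le (size l * (N * d)) (monom l e).
Proof.
elim: l e => [|p l IH] e hl.
  by move=> _ m /=; rewrite msupp1 inE => /eqP->; rewrite mdeg0.
case/allpairsP=> -[j e'] /= [jN e'l ->]; rewrite mulSn; apply: deg_leM.
  move=> m /(deg_leX (hl p (mem_head _ _))) h; apply: leq_trans h _.
  by rewrite leq_mul2r orbC ltnW //; move: jN; rewrite mem_index_iota.
by apply: IH => // q ql; apply: hl; rewrite inE ql orbT.
Qed.

(* There are more monomials in n + 1 elements than monomials of K[n] in which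
   they expand. *)
Lemma algebraic_dependence l : size l = n.+1 ->
  exists N c, msum (@mpolyC n K) N l c = 0 /\
    exists2 e, e \in exponents N (size l) & c e != 0.
Proof.
move=> sl.
have [d hd] : exists d, forall p, p \in l -> deg_le d p.
  exists (\max_(p <- l) msize p)%N => p pl m /msize_mdeg_lt /ltnW h.
  by apply: leq_trans h _; apply: leq_bigmax_seq.
(* The N ^ (n + 1) products have degree below D, so they lie in the span of D ^ n monomials. As D <=
   N * (n.+1 * d).+1, there are at most N ^ n * (n.+1 * d).+1 ^ n of these, fewer than the products
   by the choice of N. *)
pose N := ((n.+1 * d).+1 ^ n).+1.
pose D := (n.+1 * (N * d)).+1.
pose s := exponents N (size l).
pose mon_of (f : {ffun 'I_n -> 'I_D}) := [multinom (f i : nat) | i < n].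
pose A := \matrix_(i < size s, j < #|{ffun 'I_n -> 'I_D}|)
  (monom l (nth [::] s i))@_(mon_of (enum_val j)).
have lt : (#|{ffun 'I_n -> 'I_D}| < size s)%N.
  rewrite card_ffun !card_ord size_exponents sl.
  have DN : (D <= N * (n.+1 * d).+1)%N.
    by rewrite /D mulnS mulnCA -addn1 addnC leq_add2r.
  have leX a b m : (a <= b)%N -> (a ^ m <= b ^ m)%N.
    by case: m => // m ab; rewrite leq_exp2r.
  apply: leq_ltn_trans (leX _ _ n DN) _.
  rewrite expnMn expnS mulnC ltn_mul2r expn_gt0 /=.
  by [].
have : kermx A != 0.
  rewrite kermx_eq0 /row_free; apply: contraTneq lt => <-.
  by rewrite -leqNgt rank_leq_col.
case/rowV0Pn=> v /sub_kermxP vA v0.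
(* The coefficients are the entries of a left kernel vector, with 0 off the list. *)
pose c e := if insub (index e s) is Some i then v 0 i else 0.
have cE (i : 'I_(size s)) : c (nth [::] s i) = v 0 i.
  by rewrite /c index_uniq ?exponents_uniq // valK.
exists N, c; split; last first.
  have [i vi] : exists i, v 0 i != 0.
    apply: contrapT => nv; case/negP: v0; apply/eqP/rowP => i; rewrite mxE.
    by apply/eqP/negPn/negP => vi; apply: nv; exists i.
  by exists (nth [::] s i); rewrite ?mem_nth // cE.
apply/mpolyP => m; rewrite mcoeff0 /msum -/s raddf_sum /= (big_nth [::]) big_mkord.
under eq_bigr => i _ do rewrite mcoeffCM cE.
(* Monomials of degree at least D occur in no product; the others are columns of [A]. *)
case: (ltnP (mdeg m) D) => mD; last first.
  rewrite big1 // => i _; rewrite memN_msupp_eq0 ?mulr0 //; apply/negP.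
  move/(deg_le_monom hd (mem_nth [::] (ltn_ord i))); rewrite sl.
  by rewrite leqNgt; apply/negP; rewrite negbK.
have mi i : (m i < D)%N.
  by apply: leq_ltn_trans mD; rewrite mdegE (bigD1 i) //= leq_addr.
pose f : {ffun 'I_n -> 'I_D} := [ffun i => Ordinal (mi i)].
have fm : mon_of f = m by apply/mnmP => i; rewrite mnmE ffunE.
have := congr1 (fun B : 'rV_ _ => B 0 (enum_rank f)) vA; rewrite !mxE.
by move=> h; rewrite -[RHS]h; apply: eq_bigr => i _; rewrite mxE enum_rankK fm.
Qed.

End AlgebraicDependence.

Section Dimension.
Variables (K : fieldType) (V : finType).
Local Notation S := {mpoly K[#|{: V + V}|]}.
Local Notation x := (@xvar K V).
Local Notation y := (@yvar K V).

(** Pick one element in each of |V| + 2 strict inclusions. They are independent modulo [P 0], but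
    dependent modulo J_K, as [segre] embeds S / J_K in a polynomial ring in |V| + 1 variables. *)
Lemma prime_chain_det_le (I : {pred S}) e : {subset @det_ideal K V <= I} ->
  prime_chain I e -> (e <= #|V|.+1)%N.
Proof.
move=> KI [P [Pprime Pstrict]]; rewrite leqNgt; apply/negP => ltVe.
have : forall i, exists a, (i < e)%N -> a \in P i.+1 /\ a \notin P i.
  move=> i; case: (ltnP i e) => ie; last by exists 0.
  have [_ n] := Pstrict i ie; apply: contrapT => h; apply: n => a aP.
  by apply/negPn/negP => na; apply: h; exists a.
move=> /choice[a aP].
pose l := [seq a i | i <- iota 0 #|V|.+2].
have sl : size l = #|V|.+2 by rewrite size_map size_iota.
have [|N [c [c0 [ex exl cex]]]] := @algebraic_dependence K #|{: V + unit}|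
  (map (@segre K V) l).
  by rewrite size_map sl card_sum card_unit addn1.
have [c0' exl'] : msum (@mpolyC _ K) N l c \in @det_ideal K V /\
    ex \in exponents N (size l).
  split; last by rewrite size_map in exl.
  rewrite det_idealE; apply/eqP; rewrite -c0; apply: rmorph_msum => b.
  exact: evC.
case/negP: cex; apply/eqP.
apply: (@prime_chain_independent K S (@mpolyC _ K) N l c P _ _ _ ex exl').
- move=> i; rewrite sl => il; apply: (Pprime i _).1; exact: leq_trans il ltVe.
- move=> i; rewrite sl => il; have ie := leq_trans il ltVe.
  rewrite (nth_map 0%N) ?size_iota // nth_iota // add0n.
  by have [h1 h2] := aP i ie; have [h _] := Pstrict i ie.
- by apply: (Pprime 0%N isT).2; apply: KI.
Qed.

Lemma det_ideal_prime : prime_ideal (@det_ideal K V).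
Proof.
have idK : is_ideal (@det_ideal K V) by apply: bideal_ideal.
split; last first.
  move=> f g; rewrite (eq_mem_pred (@det_ideal_onT K V)) => h.
  by case: (boolP (f \in _)) => //= nf; apply: (det_ideal_on_prime h nf).
split; first exact: (ideal0 idK).
  by apply: contra (max_ideal1 K V); apply: bideal_max_ideal.
by move=> a f g; apply: idK.2.
Qed.

Lemma linear_ideal_is_prime Zx Zy : prime_ideal (@linear_ideal K V Zx Zy).
Proof.
have idK : is_ideal (@linear_ideal K V Zx Zy) by apply: bideal_ideal.
split; last first.
  move=> f g h.
  by case: (boolP (f \in _)) => //= nf; apply: (linear_ideal_prime h nf).
split; first exact: (ideal0 idK).
  by apply: contra (max_ideal1 K V); apply: bideal_max_ideal.
by move=> a f g; apply: idK.2.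
Qed.

(** The chain passes from J_K to the ideal of all x_u, then adjoins the y_u one by one in the order
    of [enum_rank]. *)
Lemma prime_chain_det (I : {pred S}) : (0 < #|V|)%N -> {subset I <= @det_ideal K V} ->
  prime_chain I #|V|.+1.
Proof.
move=> V0 IK; have [u0 _] := card_gt0P V0.
pose Z i := [pred u : V | (enum_rank u < i)%N].
pose P i : {pred S} := if i is j.+1 then linear_ideal predT (Z j) else @det_ideal K V.
have idP j : is_ideal (@linear_ideal K V predT (Z j)) by apply: bideal_ideal.
have PS i : {subset P i <= P i.+1}.
  case: i => [|j] /=.
    apply: (bideal_sub (idP 0%N)); try by move=> u; discriminate.
    move=> u w _; have xX v : x v \in linear_ideal predT (Z 0%N) by apply: bideal_x.
    exact: (idealB (idP 0%N) (ideal_mulr (idP _) _ (xX _)) (ideal_mulr (idP _) _ (xX _))).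
  apply: (linear_ideal_sub (idP j.+1)) => u hu; first exact: bideal_x.
  by apply: bideal_y; apply: ltnW.
have P0 i : {subset @det_ideal K V <= P i}.
  by elim: i => [//|i IH] f /IH /PS.
exists P; split=> [i _|i iV].
  split; last by move=> f /IK /P0.
  by case: i => [|j]; [apply: det_ideal_prime | apply: linear_ideal_is_prime].
split; first exact: PS.
case: i iV => [|j] /= iV h.
  have : x u0 \in @det_ideal K V by apply: h; apply: bideal_x.
  by rewrite (eq_mem_pred (@det_ideal_onT K V)) xvar_det_ideal_on inE.
have jV : (j < #|V|)%N by [].
have : y (enum_val (Ordinal jV)) \in linear_ideal predT (Z j).
  by apply: h; rewrite yvar_linear_ideal /= enum_valK.
by rewrite yvar_linear_ideal /= enum_valK ltnn.
Qed.

End Dimension.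

Section ConeDimension.
Variables (K : fieldType) (T : finType) (H : sgraph T).
Local Notation V := (option T).
Local Notation J := (@binomial_edge_ideal K T H).
Local Notation JG := (@binomial_edge_ideal K V (cone H)).
Local Notation Q := (@base_ideal K T H).

Lemma edge_ideal_det (W : finType) (G : sgraph W) :
  {subset @binomial_edge_ideal K W G <= @det_ideal K W}.
Proof.
move=> f; rewrite bideal_edge; apply: bideal_sub; first exact: bideal_ideal.
- by move=> u; discriminate.
- by move=> u; discriminate.
- by move=> u w _; apply: bideal_minor.
Qed.

(** Primes are pulled back along [extend]; strictness survives because [extend] and [restr] are
    inverse modulo Q. *)
Lemma prime_chain_restr (I : {pred {mpoly K[#|{: V + V}|]}}) e :
  {subset Q <= I} -> prime_chain I e -> prime_chain J e.
Proof.
move=> QI [P [Pprime Pstrict]].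
have idJ : is_ideal J by apply: ideal_gen_ideal.
pose P' i : {pred {mpoly K[#|{: T + T}|]}} := [pred g | extend g \in P i].
have restrP i f : (i <= e)%N -> (restr f \in P' i) = (f \in P i).
  move=> ie; have [PP IP] := Pprime i ie; have idPi := prime_ideal_ideal PP.
  have h : f - extend (restr f) \in P i.
    apply/IP/QI; rewrite base_idealE rmorphB /= extendK subrr; exact: (ideal0 idJ).
  rewrite inE; apply/idP/idP; first exact: (ideal_eqmod idPi h).
  exact: (ideal_eqmod' idPi h).
exists P'; split=> [i ie|i ie].
  have [PP IP] := Pprime i ie; have idPi := prime_ideal_ideal PP.
  split; last first.
    by move=> f fJ; rewrite inE; apply/IP/QI; rewrite base_idealE extendK.
  split; last by move=> f g; rewrite !inE (rmorphM (@extend K T)); apply: PP.2.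
  split; first by rewrite inE rmorph0; apply: (ideal0 idPi).
    by rewrite inE rmorph1; case: PP => -[].
  move=> a f g; rewrite !inE rmorphD (rmorphM (@extend K T)); exact: idPi.2.
have [h1 h2] := Pstrict i ie; split.
  by move=> g; rewrite !inE; apply: h1.
move=> h; apply: h2 => f; rewrite -!restrP ?(ltnW ie) //; exact: h.
Qed.

(** The first prime of the chain contains J_G, hence the product of J_K and Q, hence one of the
    two. *)
Lemma prime_chain_cone e : prime_chain JG e ->
  (e <= #|T|.+2)%N \/ prime_chain J e.
Proof.
move=> [P [Pprime Pstrict]].
have [PP IP] := Pprime 0%N isT.
have chainP (I : {pred {mpoly K[#|{: V + V}|]}}) : {subset I <= P 0%N} -> prime_chain I e.
  move=> IP0; exists P; split=> // i ie; split; first exact: (Pprime i ie).1.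
  suff : {subset P 0%N <= P i} by move=> h f /IP0 /h.
  elim: i ie => [|i IH] ie f // /(IH (ltnW ie)); exact: (Pstrict i ie).1.
case: (pselect {subset @det_ideal K V <= P 0%N}) => [KP|nKP].
  left; rewrite -card_option; apply: (prime_chain_det_le (I := @det_ideal K V)) => //.
  exact: chainP.
right; apply: (prime_chain_restr (I := Q)) => //; apply: chainP => q qQ.
have [f [fK fP]] : exists f, f \in @det_ideal K V /\ f \notin P 0%N.
  apply: contrapT => n; apply: nKP => f fK.
  by apply/negPn/negP => nf; apply: n; exists f.
apply: (prime_idealM PP _ fP); apply: IP; rewrite cone_idealP cone_idealE inE.
have idK : is_ideal (@det_ideal K V) by apply: bideal_ideal.
have idQ : is_ideal Q by apply: bideal_ideal.
by rewrite (ideal_mulr idK _ fK) (ideal_mull idQ _ qQ).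
Qed.

Lemma almost_cohen_macaulay_cone :
  connected_graph H -> ~ complete_graph H ->
  cohen_macaulay K H -> almost_cohen_macaulay K (cone H).
Proof.
move=> Hconn Hnc [d [t [[dimd maxd] dept]]]; rewrite addn0 => dt; subst t.
have T0 : (0 < #|T|)%N.
  rewrite lt0n; apply/eqP => T0; apply: Hnc => u; have := card0_eq T0 u.
  by rewrite inE.
(* As a depth d is at most n + 1, and as a dimension it is at least the length n + 1 of the chain
   starting at the ideal of all minors. *)
have dT : d = #|T|.+1.
  apply/eqP; rewrite eqn_leq (has_regular_seq_bound Hconn Hnc dept.1) /=.
  by apply: maxd; apply: prime_chain_det => //; apply: edge_ideal_det.
exists d.+1, d; split; [split| |by rewrite addn1].
- rewrite dT -card_option; apply: prime_chain_det; first by rewrite card_option.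
  exact: edge_ideal_det.
- move=> e /prime_chain_cone[|/maxd ed]; first by rewrite dT.
  exact: leqW.
- exact/(graph_depth_cone K Hconn Hnc).
Qed.

End ConeDimension.

Theorem theorem3p4 (K : fieldType) (n : nat) (H : sgraph 'I_n) :
  connected_graph H -> ~ complete_graph H ->
  (exists d : nat, graph_depth K (cone H) d /\ graph_depth K H d) /\
  (cohen_macaulay K H -> almost_cohen_macaulay K (cone H)).
Proof.
move=> Hconn Hnc; split; last exact: almost_cohen_macaulay_cone.
have [d hd] := graph_depth_exists K Hconn Hnc.
by exists d; split=> //; apply/graph_depth_cone.
Qed.
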